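(* For all $\epsilon\in(0,1/2)$, $\delta\in(0,1)$ and $d\in\mathbb{N}^+$, $$G^d_{\mathcal{U}\to\mathcal{C}}(\epsilon,\delta,n)\in\Omega(2^n/n)\quad\text{as } n\to\infty.$$
   Context: Let $\mathcal{B}=\{0,1\}$, let $\mathcal{B}^*$ be the set of finite binary strings and $|h|$ the length of $h\in\mathcal{B}^*$. For $n\in\mathbb{N}^+$, $H^n$ is the set of all functions $\mathcal{B}^n\to\mathcal{B}$ and $\Delta(\mathcal{B}^n)$ the set of probability distributions on $\mathcal{B}^n$. A learning problem is a pair $(f,\mathcal{P})$ with $f\in H^n$, $\mathcal{P}\in\Delta(\mathcal{B}^n)$; an $m$-sample dataset for it is the random sequence $[(x_j,f(x_j))]_{j=1}^m$ with $x_1,\dots,x_m$ i.i.d. $\sim\mathcal{P}$. The accuracy of $\hat f\in H^n$ is $\mathrm{acc}^{\mathcal{P}}_f(\hat f)=\Pr_{x\sim\mathcal{P}}[\hat f(x)=f(x)]$. For $\epsilon\in(0,1/2)$, $\delta\in(0,1)$, an algorithm $\mathcal{A}$ has an $(\epsilon,\delta)$-PAC-learning performance with an $m$-sample dataset on $(f,\mathcal{P})$ if for every $m'\ge m$, with probability at least $1-\delta$ over an $m'$-sample dataset $S$, $\mathrm{acc}^{\mathcal{P}}_f(\mathcal{A}(S))\ge 1-\epsilon$. An interpreter is a Turing machine computing a partial function $\varphi:\mathcal{B}^*\times\mathcal{B}^*\to\mathcal{B}\cup\{\bot\}$, where $\bot$ denotes non-halting (or invalid) output. For $f\in H^n$,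 $|f|_\varphi=\min\{|h|:\varphi(h,x)=f(x)\ \forall x\in\mathcal{B}^n\}$ ($+\infty$ if no such $h$). The learning algorithm $\mathit{MDL}^\varphi$, on a dataset $[(x_j,y_j)]_{j=1}^m$ with $x_j\in\mathcal{B}^n$, selects $h^*$ of minimal length among all $h$ with $\varphi(h,x_j)=y_j$ for all $j$ and $\varphi(h,x)\neq\bot$ for all $x\in\mathcal{B}^n$ (ties broken arbitrarily) and outputs $x\mapsto\varphi(h^*,x)$ on $\mathcal{B}^n$. $m^{\epsilon,\delta}_\varphi(f,\mathcal{P})$ is the least $m\in\mathbb{N}^+$ such that $\mathit{MDL}^\varphi$ has an $(\epsilon,\delta)$-PAC-learning performance with an $m$-sample dataset on $(f,\mathcal{P})$ ($+\infty$ if none). For interpreters $\varphi,\psi$ and $n,d\in\mathbb{N}^+$, the sample efficiency gain is $G^d_{\varphi\to\psi}(\epsilon,\delta,n)=\sup\{ m^{\epsilon,\delta}_\psi(f,\mathcal{P})/m^{\epsilon,\delta}_\varphi(f,\mathcal{P}) : f\in H^n,\ \mathcal{P}\in\Delta(\mathcal{B}^n),\ |f|_\varphi\le n^d\}$. Turing machines have alphabet $\{0,1,b\}$ ($b$ blank), a finite state set containing an initial state and two final states accept/reject; the output is $1$ if halting in accept, $0$ if halting in reject, $\bot$ otherwise; multi-tape machines have read-only input tapes and read/write work tapes, and the transition function is a finite list of rules. $E(T)$ is a fixed prefix-free binary encoding of a machine $T$ listing its rules. $\mathcal{U}$ is the universal interpreter: on $(p,x)$, if $p=E(T)u$ (concatenation)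 for a two-input-tape Turing machine $T$ (with a fixed number of work tapes) and $u\in\mathcal{B}^*$, it outputs $T(u,x)$; otherwise $\bot$. A Boolean circuit on $n$ inputs is a DAG with a unique sink (output) whose sources are labelled by input indices in $\{1,\dots,n\}$ and whose other vertices (gates) are labelled AND, OR (two incoming edges) or NOT (one incoming edge); its size $|C|$ is its number of vertices. The circuit interpreter $\mathcal{C}$ reads a program $h=0^{\lceil\log_2 n\rceil}1\,[\text{binary expansion of } n]\,0^{|C|}1\,[\text{description of vertex } i]_{i=1}^{|C|}$, each vertex being described by its label and its parents/input index using $\max\{2\lceil\log_2|C|\rceil,\lceil\log_2 n\rceil\}$ bits beyond the label bits, so a circuit $C$ on $n$ inputs has encoding length $L(|C|,n)=2\lceil\log_2 n\rceil+2+|C|(3+\max\{2\lceil\log_2|C|\rceil,\lceil\log_2 n\rceil\})$; $\mathcal{C}(h,x)$ is the circuit's output on $x\in\mathcal{B}^n$, and $\bot$ if $h$ is malformed. Hence $|f|_{\mathcal{C}}=\min\{L(|C|,n): C \text{ computes } f\}$. *)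

(* Defs.v *)
From HB Require Import structures.
From mathcomp Require Import all_boot all_order all_algebra.
From mathcomp Require Import boolp classical_sets reals constructive_ereal ereal.
Set Implicit Arguments. Unset Strict Implicit. Unset Printing Implicit Defensive.
Import Order.TTheory GRing.Theory Num.Theory.

(* Interpreters.  An interpreter phi : B^* x B^* -> B u {bot} is represented *)
(* by its graph: [phi h x b] holds iff phi(h,x) = b.  phi(h,x) = bot iff no  *)
(* b satisfies [phi h x b].                                                  *)
Definition interp := seq bool -> seq bool -> bool -> Prop.

(* Turing machines with alphabet {0,1,b} (b = None), two read-only input     *)
(* tapes (tape 0 holds u, tape 1 holds x) and k work tapes (tapes 2..k+1).   *)
(* States are natural numbers; 0 is initial, 1 is accept, 2 is reject.  The  *)
(* (finite) state set of a machine is {0,1,2} plus the states in its rules.  *)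
(* Tapes are one-way infinite, heads start on cell 0; moving left from cell  *)
(* 0 stays on cell 0.                                                        *)
Definition sym := option bool.
Inductive move := MoveL | MoveR | MoveS.

Record rule (k : nat) := Rule {
  r_state : nat;
  r_read  : k.+2.-tuple sym;
  r_next  : nat;
  r_write : k.-tuple sym;
  r_move  : k.+2.-tuple move }.

(* A machine is a finite list of rules (the first applicable rule is used). *)
Definition TM (k : nat) := seq (rule k).

Record config := Config {
  c_state : nat;
  c_heads : nat -> nat;
  c_work  : nat -> nat -> sym }. (* contents of work tape j (= tape j+2) *)

Definition init_config : config := Config 0 (fun _ => 0%N) (fun _ _ => None).

Definition read_sym (u x : seq bool) (c : config) (i : nat) : sym :=
  match i with
  | 0 => nth None (map Some u) (c_heads c 0)
  | 1 => nth None (map Some x) (c_heads c 1)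
  | j.+2 => c_work c j (c_heads c i)
  end.

Definition rule_applies k (u x : seq bool) (c : config) (r : rule k) : bool :=
  (r_state r == c_state c) &&
  (tval (r_read r) == [seq read_sym u x c i | i <- iota 0 k.+2]).

Definition do_move (m : move) (p : nat) : nat :=
  match m with MoveL => p.-1 | MoveR => p.+1 | MoveS => p end.

Definition apply_rule k (c : config) (r : rule k) : config :=
  Config (r_next r)
    (fun i => if (i < k.+2)%N then do_move (nth MoveS (r_move r) i) (c_heads c i)
              else c_heads c i)
    (fun j p => if (j < k)%N && (p == c_heads c j.+2)
                then nth None (r_write r) j else c_work c j p).

Definition step k (T : TM k) (u x : seq bool) (c : config) : option config :=
  if c_state c \in [:: 1%N; 2%N] then None else
  match [seq r <- T | rule_applies u x c r] with
  | [::] => None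
  | r :: _ => Some (apply_rule c r)
  end.

Fixpoint run k (T : TM k) (u x : seq bool) (t : nat) (c : config) : config :=
  match t with
  | 0 => c
  | t'.+1 => match step T u x c with
             | Some c' => run T u x t' c'
             | None => c
             end
  end.

Definition TM_out k (T : TM k) (u x : seq bool) (b : bool) : Prop :=
  exists t, c_state (run T u x t init_config) = (if b then 1%N else 2%N).

Definition prefix_free_enc k (E : TM k -> seq bool) : Prop :=
  forall T T' (w : seq bool), E T' = E T ++ w -> T = T'.

Definition U_interp k (E : TM k -> seq bool) : interp :=
  fun p x b => exists (T : TM k) (u : seq bool), p = E T ++ u /\ TM_out T u x b.

(* Boolean circuits, given as a list of vertices in topological order; the  *)
(* parents of vertex i are vertices with smaller index; the last vertex is   *)
(* the output.                                                               *)
Inductive vertex := VIn of nat | VAnd of nat & nat | VOr of nat & nat | VNot of nat.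
Definition circuit := seq vertex.

Definition parents (v : vertex) : seq nat :=
  match v with VIn _ => [::] | VAnd a b => [:: a; b] | VOr a b => [:: a; b]
             | VNot a => [:: a] end.

Definition vertex_ok (n i : nat) (v : vertex) : bool :=
  match v with
  | VIn j => (j < n)%N
  | VAnd a b | VOr a b => [&& (a < i)%N, (b < i)%N & a != b]
  | VNot a => (a < i)%N
  end.

(* well-formed DAG on n inputs with a unique sink (the last vertex): every  *)
(* other vertex is a parent of some vertex.                                  *)
Definition circuit_wf (n : nat) (C : circuit) : bool :=
  (0 < size C)%N &&
  all (fun i => vertex_ok n i (nth (VIn 0) C i)) (iota 0 (size C)) &&
  all (fun i => has (fun v => i \in parents v) C) (iota 0 (size C).-1).

Definition vertex_val (x : seq bool) (vs : seq bool) (v : vertex) : bool :=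
  match v with
  | VIn j => nth false x j
  | VAnd a b => nth false vs a && nth false vs b
  | VOr a b => nth false vs a || nth false vs b
  | VNot a => ~~ nth false vs a
  end.

Definition circuit_eval (C : circuit) (x : seq bool) : bool :=
  last false (foldl (fun vs v => rcons vs (vertex_val x vs v)) [::] C).

Definition clog2 (m : nat) : nat := up_log 2 m.

(* w-bit big-endian binary expansion of v (taken mod 2^w). *)
Definition bits (w v : nat) : seq bool :=
  [seq odd (v %/ 2 ^ (w - i.+1)) | i <- iota 0 w].

Definition enc_vertex (n s : nat) (v : vertex) : seq bool :=
  let W := maxn (2 * clog2 s) (clog2 n) in
  let pad l := l ++ nseq (W - size l) false in
  match v with
  | VIn j => [:: false; false] ++ pad (bits (clog2 n) j)
  | VAnd a b => [:: false; true] ++ pad (bits (clog2 s) a ++ bits (clog2 s) b)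
  | VOr a b => [:: true; false] ++ pad (bits (clog2 s) a ++ bits (clog2 s) b)
  | VNot a => [:: true; true] ++ pad (bits (clog2 s) a)
  end.

Definition enc_circuit (n : nat) (C : circuit) : seq bool :=
  nseq (clog2 n) false ++ [:: true] ++ bits (clog2 n) n ++
  nseq (size C) false ++ [:: true] ++ flatten [seq enc_vertex n (size C) v | v <- C].

Definition circ_len (s n : nat) : nat :=
  2 * clog2 n + 2 + s * (3 + maxn (2 * clog2 s) (clog2 n)).

(* The circuit interpreter C: malformed programs (not the encoding of a     *)
(* well-formed circuit on |x| inputs) give bot.                              *)
Definition C_interp : interp :=
  fun h x b => exists C : circuit,
    circuit_wf (size x) C /\ h = enc_circuit (size x) C /\ circuit_eval C x = b.

Definition dataset (n : nat) := seq (n.-tuple bool * bool).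

Definition mdl_valid (phi : interp) (n : nat) (S : dataset n) (h : seq bool) : Prop :=
  (forall p, p \in S -> phi h (tval p.1) p.2) /\
  (forall x : n.-tuple bool, exists b, phi h (tval x) b).

(* A tie-breaking rule for MDL^phi: a map from datasets to programs that     *)
(* returns a minimal-length admissible program whenever one exists.          *)
Definition MDL_selector (phi : interp) (sel : forall n, dataset n -> seq bool) : Prop :=
  forall n (S : dataset n), (exists h, mdl_valid phi S h) ->
    mdl_valid phi S (sel n S) /\
    (forall h, mdl_valid phi S h -> (size (sel n S) <= size h)%N).

Section Learning.
Variable R : realType.
Local Open Scope ring_scope.

Definition is_distr n (P : {ffun n.-tuple bool -> R}) : Prop :=
  (forall x, 0 <= P x) /\ \sum_x P x = 1.

Definition mdl_acc (phi : interp) n (f : n.-tuple bool -> bool)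
    (P : {ffun n.-tuple bool -> R}) (h : seq bool) : R :=
  \sum_x P x * (`[< phi h (tval x) (f x) >])%:R.

Definition sample_dataset n (f : n.-tuple bool -> bool) m (s : m.-tuple (n.-tuple bool))
  : dataset n := [seq (x, f x) | x <- tval s].

Definition prob_samples n (P : {ffun n.-tuple bool -> R}) m
    (E : m.-tuple (n.-tuple bool) -> Prop) : R :=
  \sum_(s : m.-tuple (n.-tuple bool)) (\prod_(j < m) P (tnth s j)) * (`[< E s >])%:R.

Definition mdl_PAC (phi : interp) sel (eps delta : R) n (f : n.-tuple bool -> bool)
    (P : {ffun n.-tuple bool -> R}) (m : nat) : Prop :=
  forall m', (m <= m')%N ->
    prob_samples P (fun s : m'.-tuple (n.-tuple bool) =>
       mdl_acc phi f P (sel n (sample_dataset f s)) >= 1 - eps) >= 1 - delta.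

Local Open Scope ereal_scope.

(* m^{eps,delta}_phi(f,P) (+oo if no such m) *)
Definition sample_complexity (phi : interp) sel (eps delta : R) n
    (f : n.-tuple bool -> bool) (P : {ffun n.-tuple bool -> R}) : \bar R :=
  ereal_inf [set (m%:R)%:E | m in [set m : nat | (0 < m)%N /\ mdl_PAC phi sel eps delta f P m]].

(* |f|_phi (+oo if no program computes f) *)
Definition desc_len (phi : interp) n (f : n.-tuple bool -> bool) : \bar R :=
  ereal_inf [set ((size h)%:R)%:E | h in
              [set h : seq bool | forall x : n.-tuple bool, phi h (tval x) (f x)]].

Definition gain (phi psi : interp) selphi selpsi (eps delta : R) (n d : nat) : \bar R :=
  ereal_sup [set r | exists (f : n.-tuple bool -> bool) (P : {ffun n.-tuple bool -> R}),
     [/\ is_distr P, desc_len phi f <= ((n ^ d)%:R)%:E &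
         r = sample_complexity psi selpsi eps delta f P /
             sample_complexity phi selphi eps delta f P]].
End Learning.

(* Main.v *)
Require Import Defs.
From HB Require Import structures.
From mathcomp Require Import all_boot all_order all_algebra.
From mathcomp Require Import boolp classical_sets reals constructive_ereal ereal.
Import Order.TTheory GRing.Theory Num.Theory.
From mathcomp Require Import zify ring lra.

(* For a large constant K there are so few circuits of size 2^n / (K n) that  *)
(* a Boolean function can be diagonalized against all of them by              *)
(* multiplicative weights: going through the inputs, output the minority of   *)
(* the weighted vote, then multiply the weight of a circuit by r + 1 if it    *)
(* was right and by r - 1 if it was wrong.  The total weight grows by a       *)
(* factor at most r per step, so no circuit is right on much more than half   *)
(* of the inputs.  This function is primitive recursive, hence computed for   *)
(* all n by one Turing machine, and a union bound over the finitely many      *)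
(* programs that are not longer shows that MDL^U learns it from O(1) samples. *)
(* MDL^C, on the other hand, can fit m samples by a decision tree with at     *)
(* most 8 m vertices, so under the uniform distribution it outputs a small,   *)
(* hence inaccurate, circuit until m reaches the order of 2^n / n.            *)

Set Implicit Arguments. Unset Strict Implicit. Unset Printing Implicit Defensive.
Local Open Scope nat_scope.

(** * Turing machines from structured tape programs *)

(** Fix [r] with 1/r <= 1/2 - eps, put K = 6 r^2 + 1, and let S be 2^n / (K n) rounded down. A
    circuit with at most S vertices is a string of 3 S digits in base n + S + 7, which is at most
    2^n once n >= 5 ([circuit_code]), so the number M of codes satisfies M^(2 r^2) < 2^(2^n)
    ([code_count_bound]). A code that agrees with the minority-vote table on a of the N = 2^n inputs
    ends with weight (r + 1)^a (r - 1)^(N - a), while the total weight is at most r^N M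
    ([agreement_bound]). Comparing the two gives a / N < 1/2 + 1/r <= 1 - eps ([agreement_gap]):
    every small circuit is too inaccurate. If 8 m <= S, then on m samples MDL^C always outputs such
    a small circuit ([mdl_circuit_size]), so its success probability is 0 and it needs at least m
    samples ([hard_complexity_ge]). For the other side, the table is written with arithmetic and
    nested [iteri]. Such functions compile to register programs ([computable_iteri]), these to
    programs on one tape ([cmd_of_correct]), and these to a Turing machine T that serves all n
    ([machine_of_computable]). The program E(T) has a length independent of n, hence so does the
    number of samples that [mdl_PAC_of_short_program] asks for, and the length is at most n^d for
    large n. The quotient of the two sample bounds is of order 2^n / n. *)

Record tape_state := TapeState { xhead : nat; whead : nat; wtape : nat -> sym }.

Definition action := sym -> sym -> sym * move * move.

Inductive cmd :=
  | Act of action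
  | Seq of cmd & cmd
  | While of (sym -> sym -> bool) & cmd.

Section TapePrograms.
Variable x : seq bool.

Definition xsym (s : tape_state) : sym := nth None (map Some x) (xhead s).
Definition wsym (s : tape_state) : sym := wtape s (whead s).

Definition act_on (o : sym * move * move) (s : tape_state) : tape_state :=
  TapeState (do_move o.1.2 (xhead s)) (do_move o.2 (whead s))
    (fun p => if p == whead s then o.1.1 else wtape s p).

Inductive exec : cmd -> tape_state -> tape_state -> Prop :=
  | ExecAct g s : exec (Act g) s (act_on (g (xsym s) (wsym s)) s)
  | ExecSeq c1 c2 s1 s2 s3 :
      exec c1 s1 s2 -> exec c2 s2 s3 -> exec (Seq c1 c2) s1 s3
  | ExecStop (b : sym -> sym -> bool) c s : ~~ b (xsym s) (wsym s) -> exec (While b c) s s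
  | ExecLoop (b : sym -> sym -> bool) c s1 s2 s3 : b (xsym s1) (wsym s1) ->
      exec c s1 s2 -> exec (While b c) s2 s3 -> exec (While b c) s1 s3.

(** The address of an instruction serves as the machine state, so the first component of the result
    is the next address. *)
Definition instr := sym -> sym -> nat * (sym * move * move).

Definition goto (q : nat) : instr := fun _ w => (q, (w, MoveS, MoveS)).

Fixpoint code_size (c : cmd) : nat :=
  match c with
  | Act _ => 1
  | Seq c1 c2 => code_size c1 + code_size c2
  | While _ c => (code_size c).+2
  end.

Fixpoint assemble (a : nat) (c : cmd) : seq instr :=
  match c with
  | Act g => [:: fun xs ws => (a.+1, g xs ws)]
  | Seq c1 c2 => assemble a c1 ++ assemble (a + code_size c1) c2
  | While b c =>
      (fun xs ws => goto (if b xs ws then a.+1 else a + (code_size c).+2) xs ws)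
        :: rcons (assemble a.+1 c) (goto a)
  end.

Lemma size_assemble a c : size (assemble a c) = code_size c.
Proof.
elim: c a => //= [c1 IH1 c2 IH2|b c IH] a.
  by rewrite size_cat IH1 IH2.
by rewrite size_rcons IH.
Qed.

Variable code : seq instr.

Definition fetch q : instr := nth (goto 0) code q.

Inductive reach : nat * tape_state -> nat * tape_state -> Prop :=
  | ReachRefl qs : reach qs qs
  | ReachStep q s qs' : q \notin [:: 1; 2] -> q < size code ->
      reach ((fetch q (xsym s) (wsym s)).1,
             act_on (fetch q (xsym s) (wsym s)).2 s) qs' ->
      reach (q, s) qs'.

Lemma reach_trans a b c : reach a b -> reach b c -> reach a c.
Proof. by elim=> // q s qs' hq hs _ IH /IH; apply: ReachStep. Qed.

Definition code_at a (l : seq instr) :=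
  a + size l <= size code /\ forall j, j < size l -> fetch (a + j) = nth (goto 0) l j.

Lemma code_at_cat a l1 l2 :
  code_at a (l1 ++ l2) -> code_at a l1 /\ code_at (a + size l1) l2.
Proof.
rewrite /code_at size_cat => -[h1 h2]; split; split; try lia.
  by move=> j hj; rewrite h2 ?nth_cat ?hj //; lia.
move=> j hj; rewrite -addnA h2 ?nth_cat; last lia.
by rewrite ltnNge leq_addr /= addKn.
Qed.

Lemma act_on_stay s : act_on (wsym s, MoveS, MoveS) s = s.
Proof.
case: s => xh wh t; rewrite /act_on /wsym /=; congr TapeState.
by apply: funext => p; case: eqP => // ->.
Qed.

Lemma reach_goto a q s : 2 < a -> code_at a [:: goto q] -> reach (a, s) (q, s).
Proof.
move=> ha [h1 h2]; have := h2 0 isT; rewrite addn0 => /= e.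
apply: ReachStep; first by rewrite !inE; lia.
  by rewrite /= in h1; lia.
by rewrite e /= act_on_stay; apply: ReachRefl.
Qed.

(** Induction on the big-step derivation. Addresses 1 and 2 are the halting states, so code placed
    above 2 is never interrupted. *)
Lemma assemble_correct c s s' a : exec c s s' -> 2 < a ->
  code_at a (assemble a c) -> reach (a, s) (a + code_size c, s').
Proof.
move=> H; elim: H a => {c s s'}
  [g s|c1 c2 s1 s2 s3 _ IH1 _ IH2|b c s hb|b c s1 s2 s3 hb _ IH1 _ IH2] a ha /=.
- move=> [h1 h2]; have := h2 0 isT; rewrite addn0 => /= e.
  apply: ReachStep; first by rewrite !inE; lia.
    by rewrite /= in h1; lia.
  by rewrite e /= addn1; apply: ReachRefl.
- move=> /code_at_cat[]; rewrite size_assemble => h1 h2.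
  apply: reach_trans (IH1 _ ha h1) _.
  by rewrite addnA; apply: IH2 => //; lia.
- move=> [/= h1 h2]; have := h2 0 isT; rewrite addn0 => /= e.
  apply: ReachStep; first by rewrite !inE; lia.
    by lia.
  by rewrite e /= (negbTE hb) act_on_stay; apply: ReachRefl.
- move=> h; move: (h) => [/= h1 h2]; have := h2 0 isT; rewrite addn0 => /= e.
  apply: ReachStep; first by rewrite !inE; lia.
    by lia.
  rewrite e /= hb act_on_stay.
  move: (h); rewrite -cat1s -cats1 => /code_at_cat[_] /=; rewrite addn1 => /code_at_cat[hc].
  rewrite size_assemble => hg.
  apply: reach_trans (IH1 a.+1 _ hc) _; first lia.
  apply: reach_trans (reach_goto _ _ hg) _; first lia.
  exact: IH2.
Qed.

End TapePrograms.

(** * From addressed code to a list of rules *)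

Section MachineOfCode.
Variables (k : nat) (code : seq instr).

Definition rule_index : seq (nat * (sym * sym)) :=
  let syms := [:: None; Some false; Some true] in
  [seq (q, ab) | q <- iota 0 (size code), ab <- [seq (a, b) | a <- syms, b <- syms]].

Lemma read_size (a b : sym) : size [:: None, a, b & nseq k (None : sym)] == k.+1.+2.
Proof. by rewrite /= size_nseq. Qed.

Lemma write_size (a : sym) : size (a :: nseq k (None : sym)) == k.+1.
Proof. by rewrite /= size_nseq. Qed.

Lemma moves_size (a b : move) : size [:: MoveS, a, b & nseq k MoveS] == k.+1.+2.
Proof. by rewrite /= size_nseq. Qed.

(** Tape 0 and the work tapes after the first are expected blank and left alone: the machine is only
    run with an empty [u]. *)
Definition rule_of (i : nat * (sym * sym)) : rule k.+1 :=
  let o := fetch code i.1 i.2.1 i.2.2 in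
  Rule i.1 (Tuple (read_size i.2.1 i.2.2)) o.1
    (Tuple (write_size o.2.1.1)) (Tuple (moves_size o.2.1.2 o.2.2)).

Definition machine : TM k.+1 := map rule_of rule_index.

Lemma uniq_rule_index : uniq rule_index.
Proof.
apply: allpairs_uniq; rewrite ?iota_uniq //.
by move=> [a b] [a' b'] _ _ [-> ->].
Qed.

Definition agrees (qs : nat * tape_state) (c : config) :=
  [/\ c_state c = qs.1, c_heads c 1 = xhead qs.2, c_heads c 2 = whead qs.2,
      c_work c 0 =1 wtape qs.2 & forall j p, c_work c j.+1 p = None].

Variable x : seq bool.

Lemma machine_step q s c : q \notin [:: 1; 2] -> q < size code -> agrees (q, s) c ->
  exists2 c', step machine [::] x c = Some c' &
    agrees ((fetch code q (xsym x s) (wsym s)).1,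
            act_on (fetch code q (xsym x s) (wsym s)).2 s) c'.
Proof.
move=> hq hs [/= e1 e2 e3 e4 e5].
rewrite /step e1 (negbTE hq) /machine filter_map.
have hr : [seq read_sym [::] x c i | i <- iota 0 k.+3]
   = [:: None, xsym x s, wsym s & nseq k None].
  rewrite /= nth_nil /xsym e2 /wsym e4 e3; congr [:: _, _, _ & _].
  apply: (@eq_from_nth _ None); first by rewrite size_map size_iota size_nseq.
  rewrite size_map size_iota => i hi.
  by rewrite (nth_map 0) ?size_iota // nth_iota // nth_nseq hi /= e5.
(* The index of a rule records exactly the state and the two symbols read, so a single rule
   applies. *)
rewrite (@eq_filter _ _ (pred1 (q, (xsym x s, wsym s)))); last first.
  move=> [q' [a b]]; rewrite /rule_applies /= e1.
  move: hr => /= ->; rewrite !eqseq_cons !eqxx /= andbT !xpair_eqE.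
  by rewrite /=.
rewrite (filter_pred1_uniq uniq_rule_index) /=; last first.
  rewrite /rule_index; apply/allpairsP; exists (q, (xsym x s, wsym s)) => /=; split => //.
    by rewrite mem_iota.
  by case: (xsym x s) => [[]|]; case: (wsym s) => [[]|].
eexists; first reflexivity.
rewrite /agrees /apply_rule /=; set o := fetch _ _ _ _.
split => //=; rewrite ?e2 ?e3 //.
  by move=> p; rewrite e4.
by move=> j p; rewrite nth_nseq if_same e5 if_same.
Qed.

Lemma machine_run qs qs' c : reach x code qs qs' -> agrees qs c ->
  exists t, agrees qs' (run machine [::] x t c).
Proof.
move=> H; elim: H c => {qs qs'} [qs|q s qs' hq hs _ IH] c hc; first by exists 0.
have [c' e hc'] := machine_step hq hs hc.
by have [t ht] := IH _ hc'; exists t.+1; rewrite /= e.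
Qed.

End MachineOfCode.

(** State 0 jumps to the body at address 3; addresses 1 and 2 are fillers, since these states halt.
    The last instruction turns the scanned work symbol into acceptance or rejection. *)
Definition program_code (c : cmd) : seq instr :=
  [:: goto 3; goto 0; goto 0] ++ assemble 3 c
    ++ [:: fun xs ws => goto (if ws == Some true then 1 else 2) xs ws].

Lemma machine_of_cmd k c x s' :
  exec x c (TapeState 0 0 (fun _ => None)) s' ->
  TM_out (machine k (program_code c)) [::] x (wsym s' == Some true).
Proof.
move=> H; set s0 := TapeState _ _ _ in H.
have hr : reach x (program_code c) (0, s0)
    (if wsym s' == Some true then 1 else 2, s').
  apply: ReachStep => //.
  rewrite (_ : act_on _ s0 = s0); last exact: act_on_stay.
  apply: (reach_trans (assemble_correct (code := program_code c) (a := 3) H isT _)).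
    split; first by rewrite /program_code !size_cat /=; lia.
    by move=> j hj; rewrite /fetch /program_code /= nth_cat hj.
  have hsz : size (program_code c) = (3 + code_size c).+1.
    by rewrite /program_code !size_cat size_assemble /=; lia.
  have hf : fetch (program_code c) (3 + code_size c) =
      fun xs ws => goto (if ws == Some true then 1 else 2) xs ws.
    by rewrite /fetch /program_code /= nth_cat size_assemble ltnn subnn.
  apply: ReachStep; [by rewrite !inE; lia | lia |].
  by rewrite hf /= act_on_stay; apply: ReachRefl.
have [] := @machine_run k _ x _ _ init_config hr; first by split.
by move=> t [/= e _ _ _ _]; exists t; rewrite e; case: ifP.
Qed.

(** * Register programs on one work tape *)

Definition regs := nat -> nat.
Definition upd (sg : regs) (i v : nat) : regs := fun j => if j == i then v else sg j.

Inductive rprog :=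
  | RSkip
  | RInc of nat
  | RDec of nat
  | RSeq of rprog & rprog
  | RWhile of nat & rprog.

(** Decrementing 0 has no derivation: on the tape, it would erase the home mark in cell 0. *)
Inductive rexec : rprog -> regs -> regs -> Prop :=
  | RExecSkip sg : rexec RSkip sg sg
  | RExecInc i sg : rexec (RInc i) sg (upd sg i (sg i).+1)
  | RExecDec i sg : 0 < sg i -> rexec (RDec i) sg (upd sg i (sg i).-1)
  | RExecSeq p1 p2 s1 s2 s3 :
      rexec p1 s1 s2 -> rexec p2 s2 s3 -> rexec (RSeq p1 p2) s1 s3
  | RExecStop i p (sg : regs) : sg i = 0 -> rexec (RWhile i p) sg sg
  | RExecLoop i p (s1 s2 s3 : regs) : 0 < s1 i ->
      rexec p s1 s2 -> rexec (RWhile i p) s2 s3 -> rexec (RWhile i p) s1 s3.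

Fixpoint reg_bound (p : rprog) : nat :=
  match p with
  | RSkip => 0
  | RInc i | RDec i => i.+1
  | RSeq p1 p2 => maxn (reg_bound p1) (reg_bound p2)
  | RWhile i p => maxn i.+1 (reg_bound p)
  end.

Section Layout.
Variable r : nat.

(* The [r] registers are interleaved in unary: the [p]-th stroke of register  *)
(* [i] sits in cell [1 + p * r + i], and cell 0 carries the unique mark       *)
(* [Some false] that brings the head back home.                               *)
Definition layout (sg : regs) (q : nat) : sym :=
  if q is q'.+1 then (if q' %/ r < sg (q' %% r) then Some true else None)
  else Some false.

Definition wmove (m : move) : cmd := Act (fun _ w => (w, MoveS, m)).

Fixpoint repeat_cmd n (c : cmd) : cmd :=
  if n is n'.+1 then Seq c (repeat_cmd n' c) else wmove MoveS.

Definition is_sym (a : sym) : sym -> sym -> bool := fun _ w => w == a.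
Definition isnt_sym (a : sym) : sym -> sym -> bool := fun _ w => w != a.

Definition go_home : cmd := While (isnt_sym (Some false)) (wmove MoveL).

Definition go_end i : cmd :=
  Seq (repeat_cmd i.+1 (wmove MoveR))
      (While (is_sym (Some true)) (repeat_cmd r (wmove MoveR))).

Fixpoint cmd_of (p : rprog) : cmd :=
  match p with
  | RSkip => wmove MoveS
  | RInc i =>
      Seq (go_end i) (Seq (Act (fun _ _ => (Some true, MoveS, MoveS))) go_home)
  | RDec i =>
      Seq (go_end i) (Seq (repeat_cmd r (wmove MoveL))
        (Seq (Act (fun _ _ => (None, MoveS, MoveS))) go_home))
  | RSeq p1 p2 => Seq (cmd_of p1) (cmd_of p2)
  | RWhile i p =>
      Seq (repeat_cmd i.+1 (wmove MoveR))
        (Seq (While (is_sym (Some true))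
                (Seq go_home (Seq (cmd_of p) (repeat_cmd i.+1 (wmove MoveR)))))
             go_home)
  end.

Variable x : seq bool.
Notation "s ~[ c ]~> s'" := (exec x c s s') (at level 70).

Lemma wsymE xh h t : wsym (TapeState xh h t) = t h. Proof. by []. Qed.

Lemma act_wmove m xh h t :
  act_on (wsym (TapeState xh h t), MoveS, m) (TapeState xh h t)
  = TapeState xh (do_move m h) t.
Proof.
rewrite /act_on /wsym /=; congr TapeState.
by apply: funext => p; case: eqP => // ->.
Qed.

Lemma exec_wmove m xh h t :
  TapeState xh h t ~[ wmove m ]~> TapeState xh (do_move m h) t.
Proof. by rewrite -act_wmove; apply: ExecAct. Qed.

Lemma exec_right n xh h t :
  TapeState xh h t ~[ repeat_cmd n (wmove MoveR) ]~> TapeState xh (h + n) t.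
Proof.
elim: n h => [|n IH] h /=; first by rewrite addn0; apply: exec_wmove.
by apply: ExecSeq (exec_wmove _ _ _ _) _; rewrite -addSnnS; apply: IH.
Qed.

Lemma exec_left n xh h t :
  TapeState xh h t ~[ repeat_cmd n (wmove MoveL) ]~> TapeState xh (h - n) t.
Proof.
elim: n h => [|n IH] h /=; first by rewrite subn0; apply: exec_wmove.
by apply: ExecSeq (exec_wmove _ _ _ _) _; rewrite subnS -subn1 subnAC subn1; apply: IH.
Qed.

Lemma exec_home xh h sg :
  TapeState xh h (layout sg) ~[ go_home ]~> TapeState xh 0 (layout sg).
Proof.
elim: h => [|h IH]; first by apply: ExecStop.
apply: ExecLoop (exec_wmove _ _ _ _) _; last exact: IH.
by rewrite /isnt_sym /wsym /=; case: ifP.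
Qed.

Hypothesis r_gt0 : 0 < r.

Lemma layout_cell sg i p : i < r ->
  layout sg (i.+1 + p * r) = if p < sg i then Some true else None.
Proof.
move=> hi; rewrite /= addnC divnMDl // modnMDl divn_small // modn_small //.
by rewrite addn0.
Qed.

Lemma layout_upd sg i v q : i < r ->
  layout (upd sg i v) q =
  if (0 < q) && (q.-1 %% r == i) then (if q.-1 %/ r < v then Some true else None)
  else layout sg q.
Proof. by case: q => //= q hi; rewrite /upd; case: (_ == i). Qed.

Lemma exec_end xh i sg : i < r ->
  TapeState xh 0 (layout sg) ~[ go_end i ]~>
  TapeState xh (i.+1 + sg i * r) (layout sg).
Proof.
move=> hi; apply: ExecSeq (exec_right _ _ _ _) _; rewrite add0n.
suff walk n p : sg i = p + n -> TapeState xh (i.+1 + p * r) (layout sg)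
    ~[ While (is_sym (Some true)) (repeat_cmd r (wmove MoveR)) ]~>
    TapeState xh (i.+1 + sg i * r) (layout sg).
  by have := walk (sg i) 0; rewrite mul0n addn0; apply.
elim: n p => [|n IH] p en.
  have ->: p = sg i by lia.
  by apply: ExecStop; rewrite /is_sym wsymE layout_cell //= ltnn.
apply: ExecLoop (exec_right _ _ _ _) _.
  by rewrite /is_sym wsymE layout_cell //= ifT //; lia.
by rewrite -addnA -mulSnr; apply: IH; lia.
Qed.

(** One statement covers the three writes that occur: adding a stroke at the end of register [i],
    erasing its last stroke, and writing a blank on the blank cell after it. *)
Lemma write_layout sg i v p (o : sym) xh : i < r ->
  (o, v) = (Some true, p.+1) \/ (o, v) = (None, p) ->
  sg i = p \/ sg i = p.+1 ->
  act_on (o, MoveS, MoveS) (TapeState xh (i.+1 + p * r) (layout sg))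
  = TapeState xh (i.+1 + p * r) (layout (upd sg i v)).
Proof.
move=> hi ho hs; rewrite /act_on /=; congr TapeState; apply: funext => q.
rewrite layout_upd //.
case: q => [|q] //=; rewrite addSn eqSS.
have hq := divn_eq q r; have hm := ltn_pmod q r_gt0.
case: (eqVneq (q %% r) i) => [e|ne].
  have -> : (q == i + p * r) = (q %/ r == p).
    apply/eqP/eqP => [->|<-]; last by rewrite {1}hq e addnC.
    by rewrite addnC divnMDl // divn_small // addn0.
  rewrite e; case: ho => -[-> ->] /=; case: eqP => [->|ne]; rewrite ?ltnSn ?ltnn //;
    by case: ifP; case: ifP => //; lia.
case: eqP => // e; case/eqP: ne.
by rewrite e addnC modnMDl modn_small.
Qed.

Definition while_loop i p : cmd :=
  While (is_sym (Some true))
    (Seq go_home (Seq (cmd_of p) (repeat_cmd i.+1 (wmove MoveR)))).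

Lemma cmd_of_correct p sg sg' xh : rexec p sg sg' -> reg_bound p <= r ->
  TapeState xh 0 (layout sg) ~[ cmd_of p ]~> TapeState xh 0 (layout sg').
Proof.
move=> H hr.
(* The loop is entered with the head on the first cell of its register. *)
suff [] : TapeState xh 0 (layout sg) ~[ cmd_of p ]~> TapeState xh 0 (layout sg') /\
  (if p is RWhile i p' then
     TapeState xh i.+1 (layout sg) ~[ while_loop i p' ]~> TapeState xh i.+1 (layout sg')
   else True) by [].
have loop i p' s1 s2 :
    TapeState xh i.+1 (layout s1) ~[ while_loop i p' ]~> TapeState xh i.+1 (layout s2) ->
    TapeState xh 0 (layout s1) ~[ cmd_of (RWhile i p') ]~> TapeState xh 0 (layout s2).
  move=> h; apply: ExecSeq (exec_right _ _ _ _) _; rewrite add0n.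
  exact: ExecSeq h (exec_home _ _ _).
have test i (s1 : regs) : i < r ->
    wsym (TapeState xh i.+1 (layout s1)) = if 0 < s1 i then Some true else None.
  by move=> hi; have := @layout_cell s1 i 0 hi; rewrite mul0n addn0.
elim: H hr => {p sg sg'} [sg|i sg|i sg hi|p1 p2 s1 s2 s3 _ IH1 _ IH2|i p sg h0
  |i p s1 s2 s3 h0 _ IH1 _ IH2] /= hr.
- by split=> //; apply: exec_wmove.
- split=> //; apply: ExecSeq (exec_end _ _ hr) _.
  apply: ExecSeq (ExecAct _ _ _) _.
  by rewrite (@write_layout _ _ (sg i).+1) //;
    [exact: exec_home | left | left].
- split=> //; apply: ExecSeq (exec_end _ _ hr) _.
  apply: ExecSeq (exec_left _ _ _ _) _.
  have -> : i.+1 + sg i * r - r = i.+1 + (sg i).-1 * r.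
    by case: (sg i) hi => // v _; rewrite mulSn /=; lia.
  apply: ExecSeq (ExecAct _ _ _) _.
  by rewrite (@write_layout _ _ (sg i).-1) //; [exact: exec_home | right | lia].
- have [h1 _] := IH1 ltac:(lia); have [h2 _] := IH2 ltac:(lia).
  by split=> //; apply: ExecSeq h1 h2.
- set P := (X in _ /\ X); suff hP : P by split=> //; apply: loop.
  by apply: ExecStop; rewrite /is_sym test ?h0 //; lia.
- have [h1 _] := IH1 ltac:(lia); have [_ h2] := IH2 hr.
  set P := (X in _ /\ X); suff hP : P by split=> //; apply: loop.
  apply: ExecLoop h2; first by rewrite /is_sym test ?h0 //; lia.
  apply: ExecSeq (exec_home _ _ _) (ExecSeq h1 _).
  exact: exec_right.
Qed.

End Layout.

(** * Computable functions *)

(** The states between iterations are given explicitly as a sequence, so that a loop is verified one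
    round at a time. *)
Lemma rexec_loop i p n (S : nat -> regs) :
  (forall m, m < n -> 0 < S m i /\ rexec p (S m) (S m.+1)) -> S n i = 0 ->
  rexec (RWhile i p) (S 0) (S n).
Proof.
move=> hS h0; suff loop m j : n = m + j -> rexec (RWhile i p) (S m) (S n).
  exact: (loop 0 n).
elim: j m => [|j IH] m e; first by rewrite addn0 in e; rewrite -e; apply: RExecStop.
have [h1 h2] := hS m ltac:(lia).
by apply: RExecLoop h1 h2 _; apply: IH; lia.
Qed.

Ltac regs_ext := let j := fresh "j" in
  apply: funext => j; rewrite /upd;
  repeat (case: eqP => ?; subst); try lia.

Definition rclear i := RWhile i (RDec i).
Definition rmove i j := RWhile i (RSeq (RDec i) (RInc j)).

Lemma rexec_eq p s s1 s2 : rexec p s s1 -> s1 = s2 -> rexec p s s2.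
Proof. by move=> h <-. Qed.

Lemma rexec_clear i sg : rexec (rclear i) sg (upd sg i 0).
Proof.
have := @rexec_loop i (RDec i) (sg i) (fun m => upd sg i (sg i - m)).
rewrite subn0 subnn (_ : upd sg i (sg i) = sg); last by regs_ext.
apply; last by rewrite /upd eqxx.
move=> m hm; rewrite /upd eqxx; split; first lia.
apply: rexec_eq (RExecDec _) _; first by rewrite eqxx; lia.
by rewrite eqxx; regs_ext.
Qed.

Lemma rexec_move i j sg : i != j ->
  rexec (rmove i j) sg (upd (upd sg j (sg j + sg i)) i 0).
Proof.
move=> /eqP hij.
have := @rexec_loop i (RSeq (RDec i) (RInc j)) (sg i)
  (fun m => upd (upd sg j (sg j + m)) i (sg i - m)).
rewrite subn0 subnn addn0 (_ : upd (upd sg j (sg j)) i (sg i) = sg); last by regs_ext.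
apply; last by rewrite /upd eqxx.
move=> m hm; split; first by rewrite /upd eqxx; lia.
apply: rexec_eq (RExecSeq (RExecDec _) (RExecInc _ _)) _.
  by rewrite /upd eqxx; lia.
by regs_ext.
Qed.

(** The program of a subterm runs while later registers already hold intermediate results; this
    locality keeps its value the intended one. *)
Definition depends_below k (F : regs -> nat) :=
  forall s1 s2 : regs, (forall j, j < k -> s1 j = s2 j) -> F s1 = F s2.

(* Quantifying over all [k' >= k] makes weakening trivial, so that programs   *)
(* can be assembled call-by-name under binders.                               *)
Definition computable k (F : regs -> nat) :=
  depends_below k F /\
  forall k', k <= k' -> exists p, forall sg : regs,
    (forall j, k' <= j -> sg j = 0) -> rexec p sg (upd sg k' (F sg)).

Lemma computable_weak k k' F : k <= k' -> computable k F -> computable k' F.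
Proof.
move=> hk [h1 h2]; split; last by move=> k'' h; apply: h2; lia.
by move=> s1 s2 h; apply: h1 => j hj; apply: h; lia.
Qed.

Lemma computable_ext k F G : (forall sg, F sg = G sg) -> computable k F -> computable k G.
Proof. by move=> /funext ->. Qed.

Lemma computable_succ k F : computable k F -> computable k (fun sg => (F sg).+1).
Proof.
move=> [h1 h2]; split; first by move=> s1 s2 h; rewrite (h1 _ _ h).
move=> k' hk; have [p hp] := h2 k' hk; exists (RSeq p (RInc k')) => sg hs.
apply: RExecSeq (hp _ hs) _; apply: rexec_eq (RExecInc _ _) _.
by regs_ext.
Qed.

Lemma computable_const k c : computable k (fun=> c).
Proof.
elim: c => [|c IH]; last exact: computable_succ.
split=> // k' _; exists RSkip => sg hs; apply: rexec_eq (RExecSkip _) _.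
by regs_ext; apply: hs.
Qed.

(** Reading is destructive, so register [i] is emptied into two scratch registers, one of which is
    then moved back. *)
Lemma computable_var k i : i < k -> computable k (fun sg => sg i).
Proof.
move=> hi; split; first by move=> s1 s2; apply.
move=> k' hk.
exists (RSeq (RWhile i (RSeq (RDec i) (RSeq (RInc k') (RInc k'.+1)))) (rmove k'.+1 i)).
move=> sg hs; have e1 := hs k' (leqnn _); have e2 := hs k'.+1 (leqnSn _).
apply: (RExecSeq (s2 := upd (upd (upd sg i 0) k' (sg i)) k'.+1 (sg i))).
  pose S m := upd (upd (upd sg i (sg i - m)) k' m) k'.+1 m.
  have := @rexec_loop i (RSeq (RDec i) (RSeq (RInc k') (RInc k'.+1))) (sg i) S.
  rewrite (_ : S 0 = sg); last by rewrite /S; regs_ext.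
  rewrite (_ : S (sg i) = upd (upd (upd sg i 0) k' (sg i)) k'.+1 (sg i)); last by rewrite /S subnn.
  apply; last by rewrite /S /upd; repeat (case: eqP => ? //); lia.
  move=> m hm; split; first by rewrite /S /upd; repeat (case: eqP => ? //); lia.
  apply: rexec_eq (RExecSeq (RExecDec _) (RExecSeq (RExecInc _ _) (RExecInc _ _))) _.
    by rewrite /S /upd; repeat (case: eqP => ? //); lia.
  by rewrite /S; regs_ext.
apply: rexec_eq (rexec_move _ _) _; first by lia.
by regs_ext.
Qed.

Lemma iteri_ext n (f g : nat -> nat -> nat) (a : nat) :
  (forall i b, f i b = g i b) -> iteri n f a = iteri n g a.
Proof. by move=> h; elim: n => //= n ->. Qed.

(** This is primitive recursion. The body is assumed computable for arbitrary index and accumulator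
    expressions, so that nested iterations are proved computable by following their syntax; the
    proof instantiates these expressions with scratch registers, and with constants for locality. *)
Lemma computable_iteri k N Z (G : regs -> nat -> nat -> nat) :
  computable k N -> computable k Z ->
  (forall k' I A, k <= k' -> computable k' I -> computable k' A ->
     computable k' (fun sg => G sg (I sg) (A sg))) ->
  computable k (fun sg => iteri (N sg) (G sg) (Z sg)).
Proof.
move=> [lN hN] [lZ hZ] hG.
have lG i a : depends_below k (fun sg => G sg i a).
  by have [] := hG k _ _ (leqnn k) (computable_const k i) (computable_const k a).
split.
  move=> s1 s2 h; rewrite (lN _ _ h) (lZ _ _ h).
  by apply: iteri_ext => i b; apply: lG.
move=> k' hk.
have [pN hpN] := hN k' hk.
have [pZ hpZ] := hZ k'.+2 ltac:(lia).
have [] := hG k'.+3 (fun sg => sg k'.+1) (fun sg => sg k'.+2) ltac:(lia)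
  (@computable_var k'.+3 k'.+1 ltac:(lia)) (@computable_var k'.+3 k'.+2 ltac:(lia)).
move=> _ /(_ k'.+3 (leqnn _)) [pG hpG].
pose body := RSeq (RDec k') (RSeq pG (RSeq (rclear k'.+2)
  (RSeq (rmove k'.+3 k'.+2) (RInc k'.+1)))).
exists (RSeq pN (RSeq pZ (RSeq (RWhile k' body)
  (RSeq (rclear k'.+1) (rmove k'.+2 k'))))) => sg hs.
pose it m := iteri m (G sg) (Z sg).
(* Register [k'] counts the remaining rounds, and the next two hold the round index and the
   accumulator. Register [k'.+3] receives the new value before it replaces the old one. *)
pose S m := upd (upd (upd sg k' (N sg - m)) k'.+1 m) k'.+2 (it m).
apply: RExecSeq (hpN _ hs) _.
apply: (RExecSeq (s2 := S 0)).
  apply: rexec_eq (hpZ _ _) _.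
    by move=> j hj; rewrite /upd; case: eqP => [|_]; [lia | apply: hs; lia].
  have -> : Z (upd sg k' (N sg)) = Z sg.
    by apply: lZ => j hj; rewrite /upd; case: eqP => //; lia.
  rewrite /S /it /=; regs_ext; first by rewrite hs; lia.
apply: (RExecSeq (s2 := S (N sg))).
  apply: rexec_loop; last by rewrite /S /upd; repeat (case: eqP => ? //); lia.
  move=> m hm; split; first by rewrite /S /upd; repeat (case: eqP => ? //); lia.
  apply: RExecSeq (RExecDec _) _; first by rewrite /S /upd; repeat (case: eqP => ? //); lia.
  set s1 := upd _ _ _.
  have s1E j : s1 j = upd (upd (upd sg k' (N sg - m).-1) k'.+1 m) k'.+2 (it m) j.
    by rewrite /s1 /S /upd; repeat (case: eqP => ? //); lia.
  apply: RExecSeq (hpG _ _) _.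
    by move=> j hj; rewrite s1E /upd; repeat (case: eqP => ? //); try lia; apply: hs; lia.
  set v := G _ _ _.
  have -> : v = it m.+1.
    rewrite /v !s1E /upd /= !eqxx (_ : (k'.+1 == k'.+2) = false); last by lia.
    by apply: lG => j hj; rewrite s1E /upd; repeat (case: eqP => ? //); lia.
  apply: RExecSeq (rexec_clear _ _) _.
  apply: RExecSeq (rexec_move _ _) _; first by lia.
  apply: rexec_eq (RExecInc _ _) _.
  apply: funext => j; rewrite /S /upd !s1E /upd.
  by repeat (case: eqP => ?; subst); try lia; rewrite hs; lia.
apply: RExecSeq (rexec_clear _ _) _.
apply: rexec_eq (rexec_move _ _) _; first by lia.
rewrite /S -/(it _); regs_ext; rewrite hs; lia.
Qed.

Definition binval (l : seq bool) : nat := foldl (fun v (b : bool) => v.*2 + b) 0 l.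

Definition input_regs (l : seq bool) : regs :=
  fun i => match i with 0 => size l | 1 => binval l | _ => 0 end.

Definition rdouble : rprog :=
  RSeq (RWhile 1 (RSeq (RDec 1) (RSeq (RInc 2) (RInc 2)))) (rmove 2 1).

(** The final state is that of [rcons l b] except that the new bit is not yet added: register
    programs cannot see the input tape, so [add_bit] does this. *)
Lemma rexec_double l b :
  rexec (RSeq rdouble (RInc 0)) (input_regs l)
    (upd (input_regs (rcons l b)) 1 (binval l).*2).
Proof.
apply: RExecSeq; first apply: RExecSeq.
- pose S m := upd (upd (input_regs l) 1 (binval l - m)) 2 m.*2.
  have := @rexec_loop 1 (RSeq (RDec 1) (RSeq (RInc 2) (RInc 2))) (binval l) S.
  rewrite (_ : S 0 = input_regs l); last by apply: funext => -[|[|[]]] //=; rewrite /S /upd /=; lia.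
  apply; last by rewrite /S /upd /=; lia.
  move=> m hm; split; first by rewrite /S /upd /=; lia.
  apply: rexec_eq (RExecSeq (RExecDec _) (RExecSeq (RExecInc _ _) (RExecInc _ _))) _.
    by rewrite /S /upd /=; lia.
  by apply: funext => -[|[|[]]] //=; rewrite /S /upd /=; lia.
- exact: rexec_move.
apply: rexec_eq (RExecInc _ _) _.
by apply: funext => -[|[|[]]] //=; rewrite /upd /= ?size_rcons; lia.
Qed.

(** * Reading the input string into registers *)

Section ReadInput.
Variables (r : nat) (x : seq bool).
Hypothesis r_gt2 : 2 < r.

Let r_gt0 : 0 < r. Proof. by lia. Qed.

Definition add_bit : cmd :=
  Seq (go_end r 1) (Seq
    (Act (fun xs _ => (if xs == Some true then Some true else None, MoveS, MoveS))) go_home).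

Definition next_input : cmd := Act (fun _ w => (w, MoveR, MoveS)).

Definition read_input : cmd :=
  While (fun xs _ => xs != None)
    (Seq (cmd_of r (RSeq rdouble (RInc 0))) (Seq add_bit next_input)).

Lemma exec_add_bit l b xh : nth None (map Some x) xh = Some b ->
  exec x add_bit (TapeState xh 0 (layout r (upd (input_regs (rcons l b)) 1 (binval l).*2)))
    (TapeState xh 0 (layout r (input_regs (rcons l b)))).
Proof.
move=> hb; set sg := upd _ _ _; apply: ExecSeq (exec_end _ r_gt0 _ _ _) _; first lia.
apply: ExecSeq (ExecAct _ _ _) _; rewrite /xsym hb.
have -> : input_regs (rcons l b) = upd sg 1 ((binval l).*2 + b).
  by apply: funext => -[|[|]] //; rewrite /upd /= /binval foldl_rcons.
rewrite (@write_layout _ r_gt0 sg 1 ((binval l).*2 + b)) //; try lia.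
- exact: exec_home.
- by case: (b); [left; rewrite addn1 | right; rewrite addn0].
Qed.

Lemma exec_read_input l m : x = l ++ m ->
  exec x read_input (TapeState (size l) 0 (layout r (input_regs l)))
    (TapeState (size x) 0 (layout r (input_regs x))).
Proof.
elim: m l => [|b m IH] l e.
  by rewrite cats0 in e; rewrite -e; apply: ExecStop; rewrite /xsym nth_default ?size_map.
have hb : nth None (map Some x) (size l) = Some b.
  by rewrite e map_cat nth_cat size_map ltnn subnn.
apply: ExecLoop; first by rewrite /xsym hb.
- apply: ExecSeq.
    by apply: (cmd_of_correct x r_gt0 _ (rexec_double l b)); rewrite /=; lia.
  apply: ExecSeq; first exact: (exec_add_bit l hb).
  exact: ExecAct.
have := IH (rcons l b); rewrite cat_rcons size_rcons => /(_ e).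
set t := layout _ _; rewrite (_ : act_on _ _ = TapeState (size l).+1 0 t) //.
rewrite /act_on wsymE /=; congr TapeState.
by apply: funext => q; case: eqP => // ->.
Qed.

End ReadInput.

Lemma machine_of_computable k F : computable 2 F ->
  exists T : TM k.+1, forall x, TM_out T [::] x (0 < F (input_regs x)).
Proof.
move=> [_ /(_ 2 (leqnn 2)) [p hp]].
pose r := maxn 3 (reg_bound p).
(* Mark cell 0, load the input, compute, and move to cell 3. This is the first cell of register 2,
   which bears a stroke exactly when the result is positive. *)
pose c := Seq (Act (fun _ _ => (Some false, MoveS, MoveS)))
  (Seq (read_input r) (Seq (cmd_of r p) (repeat_cmd 3 (wmove MoveR)))).
have r_gt0 : 0 < r by rewrite /r; lia.
exists (machine k (program_code c)) => x.
pose sg := upd (input_regs x) 2 (F (input_regs x)).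
have hx : exec x c (TapeState 0 0 (fun=> None)) (TapeState (size x) 3 (layout r sg)).
  apply: ExecSeq (ExecAct _ _ _) _.
  rewrite (_ : act_on _ _ = TapeState (size (@nil bool)) 0 (layout r (input_regs [::]))); last first.
    rewrite /act_on /=; congr TapeState; apply: funext => -[|q] //=.
    by case: (q %% r) => [|[]].
  apply: ExecSeq (exec_read_input (m := x) _ _) _ => //; first by rewrite /r; lia.
  apply: ExecSeq (cmd_of_correct _ r_gt0 _ (hp _ _) _) _.
  - by move=> [|[]].
  - by rewrite /r; lia.
  - exact: exec_right.
have := machine_of_cmd k hx.
have := @layout_cell r r_gt0 sg 2 0; rewrite wsymE mul0n addn0 => ->; last by rewrite /r; lia.
by rewrite /sg /upd /=; case: ifP.
Qed.

(** * Arithmetic and circuit evaluation on numbers *)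

Lemma computable_pred k F : computable k F -> computable k (fun sg => (F sg).-1).
Proof.
move=> hF; apply: (@computable_ext _ (fun sg => iteri (F sg) (fun i _ => i) 0)).
  by move=> sg; case: (F sg).
by apply: computable_iteri => //; apply: computable_const.
Qed.

Lemma computable_add k F G : computable k F -> computable k G ->
  computable k (fun sg => F sg + G sg).
Proof.
move=> hF hG.
apply: (@computable_ext _ (fun sg => iteri (F sg) (fun _ a => a.+1) (G sg))).
  by move=> sg; elim: (F sg) => //= n ->.
by apply: computable_iteri => // *; apply: computable_succ.
Qed.

Lemma computable_sub k F G : computable k F -> computable k G ->
  computable k (fun sg => F sg - G sg).
Proof.
move=> hF hG.
apply: (@computable_ext _ (fun sg => iteri (G sg) (fun _ a => a.-1) (F sg))).
  by move=> sg; elim: (G sg) => [|n] /=; rewrite ?subn0 // subnS => ->.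
by apply: computable_iteri => // *; apply: computable_pred.
Qed.

Lemma computable_mul k F G : computable k F -> computable k G ->
  computable k (fun sg => F sg * G sg).
Proof.
move=> hF hG.
apply: (@computable_ext _ (fun sg => iteri (F sg) (fun _ a => a + G sg) 0)).
  by move=> sg; elim: (F sg) => //= n ->; rewrite mulSn addnC.
apply: computable_iteri => //; first exact: computable_const.
by move=> *; apply: computable_add => //; apply: computable_weak hG.
Qed.

Lemma computable_exp k F G : computable k F -> computable k G ->
  computable k (fun sg => F sg ^ G sg).
Proof.
move=> hF hG.
apply: (@computable_ext _ (fun sg => iteri (G sg) (fun _ a => a * F sg) 1)).
  by move=> sg; elim: (G sg) => //= n ->; rewrite expnSr.
apply: computable_iteri => //; first exact: computable_const.
by move=> *; apply: computable_mul => //; apply: computable_weak hF.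
Qed.

(** The quotient counts the j < m with (j + 1) d <= m. The last factor vanishes only for d = 0,
    where division returns 0. *)
Lemma divn_iteri m d : m %/ d =
  iteri m (fun j a => a + (1 - (j.+1 * d - m))) 0 * (1 - (1 - d)).
Proof.
case: d => [|d]; first by rewrite divn0 muln0.
rewrite subSS sub0n subn0 muln1.
suff -> k : iteri k (fun j a => a + (1 - (j.+1 * d.+1 - m))) 0 = minn k (m %/ d.+1).
  by apply/esym/minn_idPr/leq_div.
elim: k => [|k IH] /=; first by rewrite min0n.
rewrite IH; case: (leqP (k.+1 * d.+1) m) => h.
  have hk : k.+1 <= m %/ d.+1 by rewrite leq_divRL.
  by rewrite (eqP h) subn0 (minn_idPl hk) (minn_idPl (ltnW hk)) addn1.
have hk : m %/ d.+1 <= k by rewrite -ltnS ltn_divLR.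
rewrite (minn_idPr hk) (minn_idPr (leqW hk)).
by move: h; rewrite -subn_gt0; case: (_ - m) => // j _; rewrite subSS sub0n addn0.
Qed.

Ltac computable_tac lem :=
  repeat first
    [ assumption
    | apply: computable_const
    | lem
    | apply: computable_add | apply: computable_mul | apply: computable_exp
    | apply: computable_sub | apply: computable_pred | apply: computable_succ
    | (match goal with
       | H : computable ?k ?F |- computable ?k' ?F =>
           apply: (@computable_weak k k' F _ H); lia
       end)
    | (apply: computable_iteri; last (move=> ? ? ? ? ? ?; cbv beta)) ].

Lemma computable_div k F G : computable k F -> computable k G ->
  computable k (fun sg => F sg %/ G sg).
Proof.
move=> hF hG; apply: (computable_ext (fun sg => esym (divn_iteri _ _))).
by computable_tac fail.
Qed.

Lemma computable_mod k F G : computable k F -> computable k G ->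
  computable k (fun sg => F sg %% G sg).
Proof.
move=> hF hG; apply: (@computable_ext _ (fun sg => F sg - F sg %/ G sg * G sg)).
  by move=> sg; rewrite {1}(divn_eq (F sg) (G sg)) addKn.
by computable_tac ltac:(apply: computable_div).
Qed.

Definition bit v j := (v %/ 2 ^ j) %% 2.
Definition digit b c j := (c %/ b ^ j) %% b.

(* A gate reads two positions of the bit mask [v] of all values so far; its  *)
(* type is a truth table indexed by their sum: 4 is AND, 6 is OR, 1 is NOT.   *)
Definition gate_step n b c i v :=
  v + 2 ^ (n + i) * bit (digit b c (3 * i))
    (bit v (digit b c (3 * i).+1) + bit v (digit b c (3 * i).+2)).

(** The mask starts as the [n] input bits and gate [i] sets bit n + i, so the last gate is the top
    bit. *)
Definition code_eval n s b c x := bit (iteri s (gate_step n b c) x) (n + s).-1.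

Lemma computable_bit k F G : computable k F -> computable k G ->
  computable k (fun sg => bit (F sg) (G sg)).
Proof.
by move=> hF hG; rewrite /bit;
  computable_tac ltac:(first [apply: computable_div | apply: computable_mod]).
Qed.

Lemma computable_digit k F G H : computable k F -> computable k G -> computable k H ->
  computable k (fun sg => digit (F sg) (G sg) (H sg)).
Proof.
by move=> hF hG hH; rewrite /digit;
  computable_tac ltac:(first [apply: computable_div | apply: computable_mod]).
Qed.

Lemma computable_code_eval k F1 F2 F3 F4 F5 : computable k F1 -> computable k F2 ->
  computable k F3 -> computable k F4 -> computable k F5 ->
  computable k (fun sg => code_eval (F1 sg) (F2 sg) (F3 sg) (F4 sg) (F5 sg)).
Proof.
by move=> h1 h2 h3 h4 h5; rewrite /code_eval /gate_step;
  computable_tac ltac:(first [apply: computable_bit | apply: computable_digit]).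
Qed.

Section Diagonal.
Variables (r M : nat) (g : nat -> nat -> nat).

Definition factor a b := r.+1 - 2 * ((a + b) %% 2).

Definition weight t y c := iteri y (fun z w => w * factor (g c z) (bit t z)) 1.

(** The truncated subtractions form the indicator that the codes voting 0 outweigh those voting 1,
    so bit [y] of the table is the minority vote. *)
Definition diag_step y t :=
  t + 2 ^ y * (1 - (1 - (iteri M (fun c s => s + weight t y c * (1 - g c y)) 0
                       - iteri M (fun c s => s + weight t y c * g c y) 0))).

Definition diag N := iteri N diag_step 0.
End Diagonal.

Lemma computable_diag r k FM FN (g : regs -> nat -> nat -> nat) :
  computable k FM -> computable k FN ->
  (forall k' I A, k <= k' -> computable k' I -> computable k' A ->
     computable k' (fun sg => g sg (I sg) (A sg))) ->
  computable k (fun sg => diag r (FM sg) (g sg) (FN sg)).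
Proof.
move=> hM hN hg; rewrite /diag /diag_step /weight /factor.
by computable_tac ltac:(first
  [apply: computable_bit | apply: computable_mod | apply: hg; first lia]).
Qed.

(** * Hardness of the diagonal function *)

Lemma iteri_sum m (h : nat -> nat) :
  iteri m (fun c s => s + h c) 0 = \sum_(c < m) h c.
Proof. by elim: m => [|m IH] /=; rewrite ?big_ord0 // big_ord_recr /= IH. Qed.

Lemma iteri_prod m (h : nat -> nat) :
  iteri m (fun c s => s * h c) 1 = \prod_(c < m) h c.
Proof. by elim: m => [|m IH] /=; rewrite ?big_ord0 // big_ord_recr /= IH. Qed.

Lemma bit_le1 v j : bit v j <= 1.
Proof. by rewrite /bit -ltnS ltn_mod. Qed.

Lemma bit_add_low t y b j : j < y -> bit (t + 2 ^ y * b) j = bit t j.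
Proof.
move=> hj; have -> : 2 ^ y * b = (2 ^ (y - j.+1) * b * 2) * 2 ^ j.
  by rewrite -{1}(subnK hj) expnD expnS; lia.
by rewrite /bit addnC divnMDl ?expn_gt0 // modnMDl.
Qed.

Lemma bit_add_top t y b : t < 2 ^ y -> b <= 1 -> bit (t + 2 ^ y * b) y = b.
Proof.
move=> ht hb; rewrite /bit addnC mulnC divnMDl ?expn_gt0 // divn_small // addn0.
by rewrite modn_small.
Qed.

Section DiagonalBound.
Variables (r M : nat) (g : nat -> nat -> nat).
Hypotheses (r_gt0 : 0 < r) (g_le1 : forall c z, g c z <= 1).

Local Notation table := (diag r M g).

Lemma diagS y : exists2 b, b <= 1 & table y.+1 = table y + 2 ^ y * b.
Proof. by rewrite /diag /= {1}/diag_step; eexists; last reflexivity; lia. Qed.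

Lemma diag_lt y : table y < 2 ^ y.
Proof.
elim: y => // y IH; have [b hb ->] := diagS y; rewrite expnS.
by case: b hb => [|[]] // _; lia.
Qed.

Lemma bit_diagS y z : z < y -> bit (table y.+1) z = bit (table y) z.
Proof. by move=> hz; have [b _ ->] := diagS y; rewrite bit_add_low. Qed.

Lemma weight_prod t y c : weight r g t y c = \prod_(z < y) factor r (g c z) (bit t z).
Proof. exact: iteri_prod. Qed.

Lemma weight_diagS y c : weight r g (table y.+1) y.+1 c =
  weight r g (table y) y c * factor r (g c y) (bit (table y.+1) y).
Proof.
rewrite !weight_prod big_ord_recr /=; congr (_ * _).
by apply: eq_bigr => z _; rewrite bit_diagS.
Qed.

(** If the votes for 1 and 0 weigh a and b, the codes that are right weigh min(a, b). The new total
    (r + 1) min(a, b) + (r - 1) max(a, b) is at most r (a + b). *)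
Lemma total_weightS y :
  \sum_(c < M) weight r g (table y.+1) y.+1 c <= r * \sum_(c < M) weight r g (table y) y c.
Proof.
pose w c := weight r g (table y) y c.
pose a := \sum_(c < M) w c * g c y; pose b := \sum_(c < M) w c * (1 - g c y).
have tot : \sum_(c < M) w c = a + b.
  rewrite /a /b -big_split /=; apply: eq_bigr => c _.
  by rewrite -mulnDr subnKC ?muln1.
have e : bit (table y.+1) y = 1 - (1 - (b - a)).
  rewrite (_ : table y.+1 = diag_step r M g y (table y)) // /diag_step.
  rewrite (iteri_sum M (fun c => weight r g (table y) y c * (1 - g c y))).
  rewrite (iteri_sum M (fun c => weight r g (table y) y c * g c y)).
  by rewrite bit_add_top ?diag_lt //; lia.
have split_factor v : \sum_(c < M) w c * factor r (g c y) v
    = factor r 1 v * a + factor r 0 v * b.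
  rewrite /a /b !big_distrr /= -big_split /=; apply: eq_bigr => c _.
  by have := g_le1 c y; case: (g c y) => [|[]] //= _;
    rewrite ?subn0 ?subnn ?muln0 ?muln1 ?addn0 mulnC.
under eq_bigr => c _ do rewrite weight_diagS -/(w c).
rewrite split_factor -/w tot e.
have [hab|hab] := leqP b a.
  by rewrite (eqP hab) subn0 subnn /factor /=; nia.
have -> : 1 - (1 - (b - a)) = 1 by lia.
by rewrite /factor /=; nia.
Qed.

Definition agreement N c := \sum_(z < N) (g c z == bit (table N) z).

Lemma factorE a b : a <= 1 -> b <= 1 -> factor r a b = if a == b then r.+1 else r.-1.
Proof. by rewrite /factor; case: a => [|[]] //; case: b => [|[]] // _ _ /=; lia. Qed.

Lemma weight_agreement N c :
  weight r g (table N) N c = r.+1 ^ agreement N c * r.-1 ^ (N - agreement N c).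
Proof.
have -> : N - agreement N c = \sum_(z < N) (g c z != bit (table N) z).
  suff: agreement N c + \sum_(z < N) (g c z != bit (table N) z) = N by lia.
  rewrite /agreement -big_split /= -[RHS]card_ord -sum1_card; apply: eq_bigr => z _.
  by case: (_ == _).
rewrite weight_prod /agreement !expn_sum -big_split /=; apply: eq_bigr => z _.
by rewrite factorE ?bit_le1 //; case: (_ == _); rewrite /= ?muln1 ?mul1n ?expn1.
Qed.

Lemma total_weight_bound N : \sum_(c < M) weight r g (table N) N c <= r ^ N * M.
Proof.
elim: N => [|N IH].
  rewrite expn0 mul1n -[leqRHS]card_ord -sum1_card; apply: leq_sum => c _.
  by rewrite weight_prod big_ord0.
by rewrite expnS -mulnA; apply: leq_trans (total_weightS N) _; rewrite leq_mul2l IH orbT.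
Qed.

Lemma agreement_bound N c : c < M ->
  r.+1 ^ agreement N c * r.-1 ^ (N - agreement N c) <= r ^ N * M.
Proof.
move=> hc; rewrite -weight_agreement; apply: leq_trans (total_weight_bound N).
by rewrite (bigD1 (Ordinal hc)) //= leq_addr.
Qed.

Lemma agreement_le N c : agreement N c <= N.
Proof.
rewrite -[leqRHS]card_ord -sum1_card; apply: leq_sum => z _.
by case: (_ == _).
Qed.

End DiagonalBound.

(** * Elementary inequalities between powers *)

Lemma leq_expl e m n : m <= n -> m ^ e <= n ^ e.
Proof. by case: e => // e h; rewrite leq_exp2r. Qed.

(** This is (1 - 1/q)^m >= 1 - m/q with denominators cleared; the next lemma is (1 + 1/r)^m >= 1 +
    m/r. *)
Lemma bernoulli_lower q m : 0 < q -> m <= q -> q ^ m * (q - m) <= q.-1 ^ m * q.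
Proof.
move=> hq; elim: m => [|m IH] hm; first by rewrite !expn0 subn0.
have := IH (ltnW hm); rewrite !expnS.
move: (q ^ m) (q.-1 ^ m) => A B h.
have : q.-1 * (A * (q - m)) <= q.-1 * (B * q) by rewrite leq_mul2l h orbT.
have : q * (q - m.+1) <= q.-1 * (q - m) by nia.
nia.
Qed.

Lemma bernoulli_upper r m : r ^ m * (r + m) <= r.+1 ^ m * r.
Proof.
elim: m => [|m IH]; first by rewrite !expn0 addn0.
rewrite !expnS; move: (r ^ m) (r.+1 ^ m) IH => A B h.
have : r.+1 * (A * (r + m)) <= r.+1 * (B * r) by rewrite leq_mul2l h orbT.
nia.
Qed.

Lemma double_power r : 0 < r -> 2 * r ^ r <= r.+1 ^ r.
Proof.
move=> hr; have := bernoulli_upper r r; rewrite addnn -mul2n.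
by rewrite mulnA leq_pmul2r // mulnC.
Qed.

(** Divided by r^(2 r), this reads 1 + 1/r <= (1 + 1/r)^(r + 2) (1 - 1/r)^(r - 2): a code right on r
    + 2 of every 2 r inputs beats the growth rate r. With m = r - 2 the right side is (1 - 1/r^2)^m
    (1 + 1/r)^4, and Bernoulli bounds its first factor by 1 - m/r^2. *)
Lemma biased_power r : 2 <= r -> r ^ (2 * r).-1 * r.+1 <= r.+1 ^ (r + 2) * r.-1 ^ (r - 2).
Proof.
move=> hr; set m := r - 2; have er : r = m + 2 by rewrite subnK.
have hb := @bernoulli_lower (r * r) m ltac:(nia) ltac:(nia).
have e1 : (r * r).-1 = r.+1 * r.-1 by case: (r) hr => //= s _; nia.
rewrite e1 !expnMn in hb.
have -> : (2 * r).-1 = (m + m) + 3 by lia.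
have -> : r + 2 = m + 4 by lia.
rewrite !expnD.
move: (r ^ m * r ^ m) (r.+1 ^ m) (r.-1 ^ m) hb => A B C hb.
have h5 : r * r * (r ^ 3 * r.+1) <= (r * r - m) * r.+1 ^ 4.
  have -> : r * r - m = m * m + 3 * m + 4 by rewrite er; lia.
  suff : r * r * r ^ 3 <= (m * m + 3 * m + 4) * r.+1 ^ 3.
    by move=> h; rewrite [r.+1 ^ 4]expnSr (mulnA (r * r)) (mulnA (_ + _)) leq_mul2r h orbT.
  (* In terms of m, the difference of the two sides has only nonnegative coefficients. *)
  have -> : (m * m + 3 * m + 4) * r.+1 ^ 3 = r * r * r ^ 3 +
      (2 * (m * m * m * m) + 18 * (m * m * m) + 64 * (m * m) + 109 * m + 76).
    by rewrite er !expnS !expn0; lia.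
  exact: leq_addr.
rewrite -(@leq_pmul2l (r * r)); last by nia.
apply: leq_trans (_ : A * (r * r - m) * r.+1 ^ 4 <= _).
  by rewrite -!mulnA [A * _]mulnC mulnA mulnA [A * _]mulnC leq_mul2r; lia.
by have := leq_mul hb (leqnn (r.+1 ^ 4)); lia.
Qed.

(** Otherwise the power 2 r of the weight bound and [biased_power] give (1 + 1/r)^N <= M^(2 r).
    Raising this to the power r, [double_power] yields 2^N <= M^(2 r^2), a contradiction. *)
Lemma agreement_gap r M N a : 2 <= r -> a <= N ->
  r.+1 ^ a * r.-1 ^ (N - a) <= r ^ N * M -> M ^ (2 * r * r) < 2 ^ N ->
  2 * r * a < N * (r + 2).
Proof.
move=> hr ha h1 h2; rewrite ltnNge; apply/negP => h3.
move: h2; apply/negP; rewrite -leqNgt.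
have h4 : (r.+1 ^ (r + 2) * r.-1 ^ (r - 2)) ^ N <= r ^ (N * (2 * r)) * M ^ (2 * r).
  rewrite (expnM r) -expnMn.
  apply: leq_trans (_ : (r.+1 ^ a * r.-1 ^ (N - a)) ^ (2 * r) <= _); last exact: leq_expl.
  rewrite !expnMn -!expnM.
  (* [d] measures the excess of agreements; lowering [d] factors from r + 1 to r - 1 only decreases
     the product. *)
  have [d ed] : exists d, a * (2 * r) = (r + 2) * N + d by exists (a * (2 * r) - (r + 2) * N); nia.
  have -> : (r - 2) * N = (N - a) * (2 * r) + d by nia.
  rewrite ed !expnD -!mulnA leq_mul2l; apply/orP; right.
  by rewrite [leqLHS]mulnC leq_mul2r; apply/orP; right; apply: leq_expl; lia.
have h5 : (r ^ (2 * r).-1 * r.+1) ^ N <= r ^ (N * (2 * r)) * M ^ (2 * r).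
  by apply: leq_trans h4; apply: leq_expl; apply: biased_power.
have h6 : (r ^ (2 * r).-1 * r.+1) ^ (N * r) <= r ^ (N * (2 * r) * r) * M ^ (2 * r * r).
  by have := leq_expl r h5; rewrite [X in _ <= X -> _]expnMn -!expnM.
have h7 : (2 * r ^ r) ^ N <= (r.+1 ^ r) ^ N.
  by apply: leq_expl; apply: double_power; lia.
have r_pos : 0 < r ^ (N * (2 * r) * r) by rewrite expn_gt0; lia.
rewrite -(leq_pmul2l r_pos); apply: leq_trans h6.
have -> : (r ^ (2 * r).-1 * r.+1) ^ (N * r)
    = r ^ ((2 * r).-1 * (N * r)) * (r.+1 ^ r) ^ N.
  by rewrite expnMn -!expnM [r * N]mulnC.
have -> : r ^ (N * (2 * r) * r) = r ^ ((2 * r).-1 * (N * r)) * (r ^ r) ^ N.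
  have -> : N * (2 * r) * r = (2 * r).-1 * (N * r) + r * N.
    by case: r hr {h1 h3 h4 h5 h7 r_pos} => // s _; rewrite mul2n doubleS /=; lia.
  by rewrite expnD [r ^ (r * N)]expnM.
by rewrite -mulnA -expnMn [_ * 2]mulnC leq_mul2l h7 orbT.
Qed.

(** * The hard table and its parameters *)

Definition hard_size K n := 2 ^ n %/ (K * n).
(** A digit must hold any bit position below n + S and any gate type, of which the largest is 6. *)
Definition code_base K n := n + hard_size K n + 7.
Definition code_count K n := code_base K n ^ (3 * hard_size K n).

Definition hard_table r K n :=
  diag r (code_count K n) (code_eval n (hard_size K n) (code_base K n)) (2 ^ n).

(** The base is at most 2^n, so the left side is at most 2 to the power 3 S n times 2 r^2, and 6 r^2
    S n < K S n <= 2^n unless S = 0. *)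
Lemma code_count_bound r n K : 5 <= n -> 6 * r * r < K ->
  code_count K n ^ (2 * r * r) < 2 ^ (2 ^ n).
Proof.
move=> hn hK; rewrite /code_count; set S := hard_size K n.
have hS : S * (K * n) <= 2 ^ n by apply: leq_divM.
have h16 : 2 * (n + 7) <= 2 ^ n.
  elim: n hn {S hS} => // n IH hn; case: (ltnP n 5) => h; last by rewrite expnS; have := IH h; lia.
  by have -> : n = 4 by lia.
have hB : code_base K n <= 2 ^ n.
  have : 2 * S <= 2 ^ n by apply: leq_trans hS; rewrite mulnC leq_mul2l; apply/orP; right; nia.
  by rewrite /code_base -/S; lia.
apply: (@leq_ltn_trans ((2 ^ n) ^ (3 * S * (2 * r * r)))).
  by rewrite -expnM; apply: leq_expl.
rewrite -expnM ltn_exp2l //.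
case: (posnP S) => [->|S_gt0]; first by rewrite muln0 mul0n muln0 expn_gt0.
apply: leq_trans hS.
rewrite [X in X < _](_ : _ = S * n * (6 * r * r)); last by lia.
by rewrite [K * n]mulnC (mulnA S n K) ltn_mul2l muln_gt0 S_gt0 hK andbT; lia.
Qed.

Lemma hard_table_gap r K n c : 2 <= r -> 5 <= n -> 6 * r * r < K -> c < code_count K n ->
  2 * r * (\sum_(z < 2 ^ n)
    (code_eval n (hard_size K n) (code_base K n) c z == bit (hard_table r K n) z))
  < 2 ^ n * (r + 2).
Proof.
move=> hr hn hK hc.
apply: agreement_gap (code_count_bound hn hK) => //.
  exact: agreement_le.
by apply: agreement_bound => //; [lia | move=> *; apply: bit_le1].
Qed.

(** Both [n] and the input value are read from registers, so one program serves every [n]; only [r]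
    and [K] are built in. *)
Lemma computable_hard_bit r K :
  computable 2 (fun sg => bit (hard_table r K (sg 0)) (sg 1)).
Proof.
have h0 := @computable_var 2 0 isT; have h1 := @computable_var 2 1 isT.
rewrite /hard_table /code_count /code_base /hard_size.
apply: computable_bit => //; apply: computable_diag.
- by computable_tac ltac:(apply: computable_div).
- by computable_tac fail.
move=> k' I A hk hI hA; apply: computable_code_eval;
  by computable_tac ltac:(apply: computable_div).
Qed.

(** * Numeric codes of circuits *)

Lemma binval_rcons l b : binval (rcons l b) = (binval l).*2 + b.
Proof. by rewrite /binval foldl_rcons. Qed.

Lemma binval_lt l : binval l < 2 ^ size l.
Proof.
elim/last_ind: l => // l b IH; rewrite binval_rcons size_rcons expnS.
by case: b; lia.
Qed.

Lemma bit_binval l j : j < size l -> bit (binval l) (size l - j.+1) = nth false l j.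
Proof.
elim/last_ind: l => // l b IH; rewrite size_rcons binval_rcons nth_rcons /bit => hj.
case: ltnP => h; last first.
  have -> : j = size l by lia.
  by rewrite eqxx subnn expn0 divn1 modn2 oddD odd_double oddb.
rewrite -IH // subSn // expnS divnMA.
by rewrite -[in RHS](half_bit_double (binval l) b) -divn2 addnC.
Qed.

Lemma binval_inj l1 l2 : size l1 = size l2 -> binval l1 = binval l2 -> l1 = l2.
Proof.
move=> hs hn; apply: (@eq_from_nth _ false) => // i hi.
have: nth false l1 i = nth false l2 i :> nat by rewrite -!bit_binval -?hs // hn.
by do 2!case: (nth _ _ _).
Qed.

Lemma digitE b m c a : c < b ^ m -> a < b ->
  digit b (c + a * b ^ m) m = a /\ forall j, j < m -> digit b (c + a * b ^ m) j = digit b c j.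
Proof.
move=> hc ha; have b_gt0 : 0 < b by lia.
split.
  by rewrite /digit addnC divnMDl ?expn_gt0 ?b_gt0 // divn_small // addn0 modn_small.
move=> j hj; have -> : a * b ^ m = (a * b ^ (m - j.+1) * b) * b ^ j.
  by rewrite -{1}(subnK hj) expnD expnS; lia.
by rewrite /digit addnC divnMDl ?expn_gt0 ?b_gt0 // modnMDl.
Qed.

Lemma digits_exist b m (h : nat -> nat) : (forall j, j < m -> h j < b) ->
  exists2 c, c < b ^ m & forall j, j < m -> digit b c j = h j.
Proof.
elim: m => [|m IH] hh; first by exists 0.
have [c hc hd] := IH (fun j hj => hh j (ltnW hj)).
have [e1 e2] := digitE hc (hh m (ltnSn m)).
exists (c + h m * b ^ m).
  rewrite expnS; have := hh m (ltnSn m); move: (b ^ m) hc => u hc hm.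
  have : (h m).+1 * u <= b * u by rewrite leq_mul2r hm orbT.
  by lia.
move=> j; rewrite ltnS leq_eqVlt => /orP[/eqP->//|hj].
by rewrite e2 // hd.
Qed.

Definition vals (x : seq bool) (C : circuit) : seq bool :=
  foldl (fun vs v => rcons vs (vertex_val x vs v)) [::] C.

Lemma vals_rcons x C v : vals x (rcons C v) = rcons (vals x C) (vertex_val x (vals x C) v).
Proof. by rewrite /vals foldl_rcons. Qed.

Lemma size_vals x C : size (vals x C) = size C.
Proof. by elim/last_ind: C => // C v IH; rewrite vals_rcons !size_rcons IH. Qed.

Lemma circuit_evalE C x : circuit_eval C x = nth false (vals x C) (size C).-1.
Proof. by rewrite /circuit_eval -/(vals x C) -(size_vals x) nth_last. Qed.

Section CircuitCode.
Variables (n s b : nat) (C : circuit).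
Hypotheses (C_wf : circuit_wf n C) (C_size : size C <= s) (b_large : n + s + 7 <= b).

(* The padding gates copy the output. *)
Let padded := C ++ nseq (s - size C) (VAnd (size C).-1 (size C).-1).

(** An input vertex becomes the AND of an input bit with itself; its position is n - j - 1 because
    strings are read with the most significant bit first. *)
Definition gate_code (v : vertex) : nat * nat * nat :=
  match v with
  | VIn j => (4, n - j.+1, n - j.+1)
  | VAnd a b => (4, n + a, n + b)
  | VOr a b => (6, n + a, n + b)
  | VNot a => (1, n + a, n + a)
  end.

Let size_padded : size padded = s.
Proof. by rewrite size_cat size_nseq subnKC. Qed.

Let C_gt0 : 0 < size C.
Proof. by move: C_wf => /andP[/andP[]]. Qed.

(** A padding gate has two equal parents, which [vertex_ok] forbids; this weaker condition covers
    circuit and padding alike. *)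
Definition vertex_below i v :=
  match v with
  | VIn j => j < n
  | VAnd a b | VOr a b => (a < i) && (b < i)
  | VNot a => a < i
  end.

Lemma vertex_ok_below i v : vertex_ok n i v -> vertex_below i v.
Proof. by case: v => //= a c /and3P[-> ->]. Qed.

Let padded_below i : i < s -> vertex_below i (nth (VIn 0) padded i).
Proof.
move=> hi; rewrite nth_cat; case: ltnP => h.
  apply: vertex_ok_below; move: C_wf => /andP[/andP[_ /allP h'] _].
  by apply: h'; rewrite mem_iota.
by rewrite nth_nseq ifT /=; lia.
Qed.

(** Digits 3 i, 3 i + 1 and 3 i + 2 store the type and the two operands of gate i. Padding to
    exactly [s] gates gives all circuits of size at most [s] codes of one length. *)
Lemma circuit_code : exists2 c, c < b ^ (3 * s) &
  forall x, size x = n -> code_eval n s b c (binval x) = circuit_eval C x.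
Proof.
pose h j := let o := gate_code (nth (VIn 0) padded (j %/ 3)) in
  match j %% 3 with 0 => o.1.1 | 1 => o.1.2 | _ => o.2 end.
have [c hc hd] : exists2 c, c < b ^ (3 * s) & forall j, j < 3 * s -> digit b c j = h j.
  apply: digits_exist => j hj; have := padded_below (i := j %/ 3) ltac:(lia).
  rewrite /h; have : j %/ 3 < s by lia.
  move: (j %/ 3) (j %% 3) => q m hq.
  by case: (nth _ _ _) => [i|a1 a2|a1 a2|a1] /= hv; case: m => [|[|m]] //=; lia.
exists c => // x hx.
(* After i gates, the mask holds the input in its low [n] bits and the values of the first i
   vertices above them. *)
have inv i : i <= s -> let v := iteri i (gate_step n b c) (binval x) in
    [/\ v < 2 ^ (n + i), (forall j, j < n -> bit v (n - j.+1) = nth false x j) &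
        forall j, j < i -> bit v (n + j) = nth false (vals x (take i padded)) j].
  elim: i => [|i IH] hi /=.
    rewrite addn0; split=> //; first by rewrite -hx binval_lt.
    by move=> j hj; rewrite -hx bit_binval // hx.
  have [h1 h2 h3] := IH (ltnW hi); move: (iteri i _ _) h1 h2 h3 => v h1 h2 h3.
  set w := vals x (take i padded) in h3 *.
  have -> : gate_step n b c i v =
      v + 2 ^ (n + i) * vertex_val x w (nth (VIn 0) padded i).
    rewrite /gate_step !hd; try lia.
    rewrite /h.
    have -> : 3 * i %/ 3 = i by lia.
    have -> : (3 * i).+1 %/ 3 = i by lia.
    have -> : (3 * i).+2 %/ 3 = i by lia.
    have -> : 3 * i %% 3 = 0 by lia.
    have -> : (3 * i).+1 %% 3 = 1 by lia.
    have -> : (3 * i).+2 %% 3 = 2 by lia.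
    congr (_ + _ * _); move: (padded_below hi).
    case: (nth _ _ _) => [j|a1 a2|a1 a2|a1] /=.
    - by move=> hj; rewrite h2 //; case: (nth _ _ _).
    - by move=> /andP[ha1 ha2]; rewrite !h3 //; do 2!case: (nth _ _ _).
    - by move=> /andP[ha1 ha2]; rewrite !h3 //; do 2!case: (nth _ _ _).
    - by move=> ha1; rewrite !h3 //; case: (nth _ _ _).
  have hvb := leq_b1 (vertex_val x w (nth (VIn 0) padded i)).
  have ht : vals x (take i.+1 padded) = rcons w (vertex_val x w (nth (VIn 0) padded i)).
    by rewrite (take_nth (VIn 0)) ?size_padded // vals_rcons.
  split.
  - by rewrite addnS expnS; move: (vertex_val _ _ _) => o; case: o; lia.
  - by move=> j hj; rewrite bit_add_low ?h2 //; lia.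
  move=> j; rewrite ltnS leq_eqVlt ht nth_rcons size_vals size_takel ?size_padded; last lia.
  case/orP=> [/eqP->|hj]; first by rewrite ltnn eqxx bit_add_top.
  by rewrite hj bit_add_low ?h3 //; lia.
have [_ _ h3] := inv s (leqnn s); rewrite take_oversize ?size_padded // in h3.
rewrite /code_eval.
have -> : (n + s).-1 = n + s.-1 by lia.
rewrite h3; last lia.
rewrite circuit_evalE; congr (nat_of_bool _).
have pad m : nth false (vals x (C ++ nseq m (VAnd (size C).-1 (size C).-1))) (size C + m).-1
    = nth false (vals x C) (size C).-1 /\
    nth false (vals x (C ++ nseq m (VAnd (size C).-1 (size C).-1))) (size C).-1
    = nth false (vals x C) (size C).-1.
  elim: m => [|m [IH1 IH2]]; first by rewrite cats0 addn0.
  have -> : nseq m.+1 (VAnd (size C).-1 (size C).-1) =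
    rcons (nseq m (VAnd (size C).-1 (size C).-1)) (VAnd (size C).-1 (size C).-1).
    by elim: (m) => //= k ->.
  rewrite -rcons_cat vals_rcons !nth_rcons size_vals size_cat size_nseq addnS /=.
  by rewrite ltnn eqxx IH2 andbb ifT; [| lia].
by have [<- _] := pad (s - size C); rewrite subnKC.
Qed.

End CircuitCode.

(** * Circuit encodings and decision trees *)

Lemma size_bits w v : size (bits w v) = w.
Proof. by rewrite size_map size_iota. Qed.

Lemma binval_bits w v : v < 2 ^ w -> binval (bits w v) = v.
Proof.
elim: w v => [|w IH] v hv; first by rewrite expn0 in hv; rewrite /binval /=; lia.
have -> : bits w.+1 v = rcons (bits w v./2) (odd v).
  rewrite /bits -[in iota _ _](addn1 w) iotaD map_cat /= add0n subnn expn0 divn1 cats1.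
  congr (rcons _ _); apply/eq_in_map => i; rewrite mem_iota => /= hi.
  by rewrite subSn // expnS divnMA divn2.
rewrite binval_rcons IH; first by rewrite addnC odd_double_half.
by move: hv; rewrite expnS -[in X in X -> _](odd_double_half v); lia.
Qed.

Lemma bits_inj w v1 v2 : v1 < 2 ^ w -> v2 < 2 ^ w -> bits w v1 = bits w v2 -> v1 = v2.
Proof. by move=> h1 h2 e; rewrite -(binval_bits h1) e binval_bits. Qed.

Lemma lt_clog2 a s : a < s -> a < 2 ^ clog2 s.
Proof. by move=> h; apply: leq_trans h _; apply: up_logP. Qed.

Lemma size_enc_vertex n s v :
  size (enc_vertex n s v) = 2 + maxn (2 * clog2 s) (clog2 n).
Proof.
by rewrite /enc_vertex; case: v => *; rewrite /= !size_cat size_nseq ?size_cat !size_bits; lia.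
Qed.

Lemma enc_vertex_inj n s v1 v2 : vertex_below n s v1 -> vertex_below n s v2 ->
  enc_vertex n s v1 = enc_vertex n s v2 -> v1 = v2.
Proof.
pose pad (l : seq bool) := l ++ nseq (maxn (2 * clog2 s) (clog2 n) - size l) false.
have pad_inj l1 l2 : size l1 = size l2 -> pad l1 = pad l2 -> l1 = l2.
  by move=> hs; rewrite /pad hs => /eqP; rewrite eqseq_cat // => /andP[/eqP].
have two a b a' b' : a < s -> b < s -> a' < s -> b' < s ->
    pad (bits (clog2 s) a ++ bits (clog2 s) b) = pad (bits (clog2 s) a' ++ bits (clog2 s) b') ->
    a = a' /\ b = b'.
  move=> ha hb ha' hb' /pad_inj; rewrite !size_cat !size_bits => /(_ erefl) /eqP.
  rewrite eqseq_cat ?size_bits // => /andP[/eqP h1 /eqP h2].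
  by split; [apply: bits_inj h1 | apply: bits_inj h2]; apply: lt_clog2.
case: v1 => [j|a b|a b|a]; case: v2 => [j'|a' b'|a' b'|a'] //; rewrite /enc_vertex /= -!/(pad _).
- move=> h h' [] /pad_inj; rewrite !size_bits => /(_ erefl) e; congr VIn.
  by apply: bits_inj e; apply: lt_clog2.
- by move=> /andP[h1 h2] /andP[h1' h2'] [] /two [] // -> ->.
- by move=> /andP[h1 h2] /andP[h1' h2'] [] /two [] // -> ->.
- move=> h h' [] /pad_inj; rewrite !size_bits => /(_ erefl) e; congr VNot.
  by apply: bits_inj e; apply: lt_clog2.
Qed.

Lemma size_enc_vertices n s (C : circuit) :
  size (flatten [seq enc_vertex n s v | v <- C])
  = size C * (2 + maxn (2 * clog2 s) (clog2 n)).
Proof. by elim: C => //= v C IH; rewrite size_cat IH size_enc_vertex mulSn. Qed.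

Lemma size_enc_circuit n C : size (enc_circuit n C) = circ_len (size C) n.
Proof.
rewrite /enc_circuit !size_cat !size_nseq size_bits size_enc_vertices /= /circ_len.
by move: (maxn _ _) => W; lia.
Qed.

Lemma unary_inj a b (l1 l2 : seq bool) :
  nseq a false ++ true :: l1 = nseq b false ++ true :: l2 -> a = b /\ l1 = l2.
Proof. by elim: a b => [|a IH] [|b] //= [] => [->|/IH[-> ->]]. Qed.

Lemma enc_vertices_inj n s (C1 C2 : circuit) : size C1 = size C2 ->
  (forall i, i < size C1 -> vertex_below n s (nth (VIn 0) C1 i)) ->
  (forall i, i < size C1 -> vertex_below n s (nth (VIn 0) C2 i)) ->
  flatten [seq enc_vertex n s v | v <- C1] = flatten [seq enc_vertex n s v | v <- C2] ->
  C1 = C2.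
Proof.
elim: C1 C2 => [|v1 C1 IH] [|v2 C2] //= [hs] h1 h2 /eqP.
rewrite eqseq_cat ?size_enc_vertex // => /andP[/eqP e1 /eqP e2].
have -> : v1 = v2 by apply: enc_vertex_inj (h1 0 isT) (h2 0 isT) e1.
rewrite (IH C2) //.
  by move=> i; apply: (h1 i.+1).
by move=> i; apply: (h2 i.+1).
Qed.

Lemma circuit_wf_below n C i : circuit_wf n C -> i < size C ->
  vertex_below n i (nth (VIn 0) C i).
Proof.
move=> /andP[/andP[_ /allP h] _] hi; apply: vertex_ok_below.
by apply: h; rewrite mem_iota.
Qed.

Lemma vertex_below_weak n i j v : i <= j -> vertex_below n i v -> vertex_below n j v.
Proof. by case: v => //= *; lia. Qed.

(** The unary size ends at its first [true], and the vertex blocks that follow have equal width.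
    Hence a program of [C_interp] determines its circuit. *)
Lemma enc_circuit_inj n C1 C2 : circuit_wf n C1 -> circuit_wf n C2 ->
  enc_circuit n C1 = enc_circuit n C2 -> C1 = C2.
Proof.
move=> w1 w2; rewrite /enc_circuit /= => /eqP; rewrite eqseq_cat // => /andP[_ /eqP []] /eqP.
rewrite eqseq_cat // => /andP[_ /eqP] /unary_inj [hs].
rewrite -hs; apply: enc_vertices_inj => // i hi.
  by apply: vertex_below_weak (circuit_wf_below w1 hi); lia.
by rewrite hs in hi *; apply: vertex_below_weak (circuit_wf_below w2 hi); lia.
Qed.

Lemma circ_len_le s1 s2 n : s1 <= s2 -> circ_len s1 n <= circ_len s2 n.
Proof.
move=> h; rewrite /circ_len leq_add2l leq_mul // leq_add2l geq_max leq_maxr andbT.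
by apply: leq_trans (leq_maxl _ _); rewrite leq_mul2l /=; apply: leq_up_log.
Qed.

(** Strict growth converts the length minimality of MDL into a bound on the number of vertices. *)
Lemma circ_len_lt s1 s2 n : s1 < s2 -> circ_len s1 n < circ_len s2 n.
Proof.
move=> h; apply: leq_trans (circ_len_le n h); rewrite /circ_len ltn_add2l.
apply: leq_ltn_trans (_ : s1 * (3 + maxn (2 * clog2 s1.+1) (clog2 n)) < _).
  have := circ_len_le n (leqnSn s1); rewrite /circ_len leq_add2l => h'.
  rewrite leq_mul2l leq_add2l geq_max leq_maxr andbT.
  by apply/orP; right; apply: leq_trans (leq_maxl _ _); rewrite leq_mul2l /=; apply: leq_up_log.
by rewrite ltn_mul2r ltnSn.
Qed.

(** * Circuits for decision trees *)

Definition shift_vertex k v :=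
  match v with
  | VIn j => VIn j
  | VAnd a b => VAnd (k + a) (k + b)
  | VOr a b => VOr (k + a) (k + b)
  | VNot a => VNot (k + a)
  end.

Lemma vals_shift x C1 C2 :
  vals x (C1 ++ map (shift_vertex (size C1)) C2) = vals x C1 ++ vals x C2.
Proof.
elim/last_ind: C2 => [|C2 v IH]; first by rewrite !cats0.
rewrite map_rcons -rcons_cat !vals_rcons IH -rcons_cat; congr (rcons _ _).
have e a : nth false (vals x C1 ++ vals x C2) (size C1 + a) = nth false (vals x C2) a.
  by rewrite nth_cat size_vals ltnNge leq_addr /= addKn.
by case: v => [j|a b|a b|a] //=; rewrite !e.
Qed.

Lemma circuit_wfP n C : circuit_wf n C <->
  [/\ 0 < size C, forall i, i < size C -> vertex_ok n i (nth (VIn 0) C i)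
    & forall i, i < (size C).-1 -> has (fun v => i \in parents v) C].
Proof.
split.
  move=> /andP[/andP[h1 /allP h2] /allP h3]; split=> // i hi.
    by apply: h2; rewrite mem_iota.
  by apply: h3; rewrite mem_iota.
move=> [h1 h2 h3]; apply/andP; split; first (apply/andP; split=> //).
  by apply/allP => i; rewrite mem_iota /= add0n; apply: h2.
by apply/allP => i; rewrite mem_iota /= add0n; apply: h3.
Qed.

(** There are no constant vertices, so constants are obtained by joining input 0 to its negation. *)
Definition leaf_circuit (b : bool) : circuit :=
  [:: VIn 0; VNot 0; if b then VOr 0 1 else VAnd 0 1].

Lemma leaf_circuit_wf n b : 0 < n -> circuit_wf n (leaf_circuit b).
Proof.
move=> hn; apply/circuit_wfP; split=> //.
  by move=> [|[|[|i]]] //= _; case: b.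
by move=> [|[|i]] //= _; case: b.
Qed.

Lemma leaf_circuit_eval b x : circuit_eval (leaf_circuit b) x = b.
Proof. by case: b; rewrite /circuit_eval /=; case: (nth _ _ _). Qed.

Definition mux_circuit j (C1 C2 : circuit) : circuit :=
  let p := size C1 + size C2 in
  (C1 ++ map (shift_vertex (size C1)) C2)
    ++ [:: VIn j; VNot p; VAnd p (size C1).-1; VAnd p.+1 p.-1; VOr p.+2 p.+3].

Lemma size_mux_circuit j C1 C2 : size (mux_circuit j C1 C2) = size C1 + size C2 + 5.
Proof. by rewrite !size_cat size_map. Qed.

Lemma mux_circuit_wf n j C1 C2 : j < n -> circuit_wf n C1 -> circuit_wf n C2 ->
  circuit_wf n (mux_circuit j C1 C2).
Proof.
move=> hj /circuit_wfP[a1 a2 a3] /circuit_wfP[b1 b2 b3].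
apply/circuit_wfP; rewrite size_mux_circuit; split; first by lia.
  move=> i hi; rewrite /mux_circuit !nth_cat size_cat size_map.
  case: ltnP => h1; [case: ltnP => h2|].
  - exact: a2.
  - rewrite (nth_map (VIn 0)); last lia.
    have := b2 (i - size C1) ltac:(lia).
    by case: (nth _ _ _) => [l|a b|a b|a] /=; lia.
  have [m [em hm]] : exists m, i = size C1 + size C2 + m /\ m < 5.
    by exists (i - (size C1 + size C2)); lia.
  rewrite em addKn.
  by case: m em hm => [|[|[|[|[|m]]]]] //= em hm; lia.
move=> i hi; rewrite /mux_circuit !has_cat has_map /= !inE.
have [h1|h1] := ltnP i (size C1).-1; first by rewrite a3.
have [h2|h2] := ltnP i (size C1); first by apply/orP; right; lia.
have [h3|h3] := ltnP i (size C1 + size C2).-1; last by apply/orP; right; lia.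
apply/orP; left; apply/orP; right.
have := b3 (i - size C1) ltac:(lia).
apply: sub_has => -[l|a b|a b|a] //=; rewrite !inE.
- by case/orP=> /eqP <-; apply/orP; [left | right]; apply/eqP; lia.
- by case/orP=> /eqP <-; apply/orP; [left | right]; apply/eqP; lia.
- by move/eqP=> <-; apply/eqP; lia.
Qed.

Lemma mux_circuit_eval j C1 C2 x : 0 < size C1 -> 0 < size C2 ->
  circuit_eval (mux_circuit j C1 C2) x =
  if nth false x j then circuit_eval C1 x else circuit_eval C2 x.
Proof.
move=> h1 h2; rewrite /circuit_eval /mux_circuit foldl_cat.
rewrite -/(vals x (C1 ++ _)) vals_shift; set p := size C1 + size C2.
set w := vals x C1 ++ vals x C2; have sw : size w = p by rewrite size_cat !size_vals.
have w1 : nth false w (size C1).-1 = circuit_eval C1 x.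
  by rewrite circuit_evalE nth_cat size_vals ifT //; lia.
have w2 : nth false w p.-1 = circuit_eval C2 x.
  rewrite circuit_evalE nth_cat size_vals ifF; last lia.
  by congr nth; lia.
rewrite /= last_rcons !nth_rcons !size_rcons sw !ltnn !eqxx.
have -> : p < p.+1 by [].
have -> : p.+1 < p.+2 by [].
have -> : p.+2 < p.+3 by [].
have -> : (size C1).-1 < p.+1 by lia.
have -> : (size C1).-1 < p by lia.
have -> : p.-1 < p.+2 by lia.
have -> : p.-1 < p.+1 by lia.
have -> : p.-1 < p by lia.
by rewrite w1 w2; case: (nth _ _ _); rewrite ?orbF.
Qed.

(** While two points of [L] differ, split [L] at a coordinate where they do; both parts are
    nonempty. The summand 5 makes the count close exactly: a leaf has 3 + 5 = 8, and joining parts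
    of lengths a and b gives (8 a - 5) + (8 b - 5) + 5 + 5 = 8 (a + b). *)
Lemma decision_tree n (f : n.-tuple bool -> bool) (L : seq (n.-tuple bool)) :
  0 < n -> 0 < size L -> exists C, [/\ circuit_wf n C, size C + 5 <= 8 * size L
    & forall x, x \in L -> circuit_eval C x = f x].
Proof.
move=> hn; elim: {L}(size L) {-2}L (leqnn (size L)) => [|m IH] [|x0 L] //= hm _.
have [/allP hall|] := boolP (all (pred1 x0) L).
  exists (leaf_circuit (f x0)); split; [exact: leaf_circuit_wf | rewrite /=; lia |].
  by move=> x; rewrite inE leaf_circuit_eval => /orP[/eqP->//|/hall /eqP->].
rewrite -has_predC => /hasP[y yL /= hy].
have [j hj] : exists j, tnth x0 j != tnth y j.
  apply/existsP; apply: contraNT hy => /existsPn h.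
  by apply/eqP/eq_from_tnth => j; apply/esym/eqP; have := h j; rewrite negbK.
pose q x := tnth (x : n.-tuple bool) j.
pose L' := x0 :: L.
have hsz : size ([seq x <- L' | q x]) + size ([seq x <- L' | ~~ q x]) = (size L).+1.
  by rewrite !size_filter; apply: (count_predC q L').
have [x1 h1] : exists x1, x1 \in [seq x <- L' | q x].
  case e : (q x0); first by exists x0; rewrite mem_filter e inE eqxx.
  exists y; rewrite mem_filter inE yL orbT andbT.
  by move: hj; rewrite -/(q x0) -/(q y) e; case: (q y).
have [x2 h2] : exists x2, x2 \in [seq x <- L' | ~~ q x].
  case e : (q x0); last by exists x0; rewrite mem_filter /= e inE eqxx.
  exists y; rewrite mem_filter inE yL orbT andbT /=.
  by move: hj; rewrite -/(q x0) -/(q y) e; case: (q y).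
have s1 : 0 < size ([seq x <- L' | q x]) by case: ([seq x <- L' | q x]) h1.
have s2 : 0 < size ([seq x <- L' | ~~ q x]) by case: ([seq x <- L' | ~~ q x]) h2.
have [C1 [c1 d1 e1]] := IH ([seq x <- L' | q x]) ltac:(lia) s1.
have [C2 [c2 d2 e2]] := IH ([seq x <- L' | ~~ q x]) ltac:(lia) s2.
exists (mux_circuit j C1 C2); split; first exact: mux_circuit_wf.
  by rewrite size_mux_circuit; lia.
move=> x hx; rewrite mux_circuit_eval; last 2 first.
  by case/circuit_wfP: c1.
  by case/circuit_wfP: c2.
rewrite -tnth_nth; case e : (tnth x j).
  by apply: e1; rewrite mem_filter /q e.
by apply: e2; rewrite mem_filter /= /q e.
Qed.

(** * Sample complexity *)

Fixpoint strings (l : nat) : seq (seq bool) :=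
  if l is l'.+1 then
    [::] :: map (cons true) (strings l') ++ map (cons false) (strings l')
  else [:: [::]].

Lemma mem_strings l h : (size h <= l)%N -> h \in strings l.
Proof.
elim: l h => [|l IH] [|b h] //= hh; rewrite inE mem_cat /=.
by case: b; rewrite map_f ?orbT //; apply: IH.
Qed.

Section Probability.
Variable R : realType.
Local Open Scope ring_scope.

Lemma sum_tuple_prod (T : finType) (F : T -> R) m :
  \sum_(s : m.-tuple T) \prod_(j < m) F (tnth s j) = (\sum_x F x) ^+ m.
Proof.
have <- : \prod_(j < m) \sum_x F x = (\sum_x F x) ^+ m.
  by rewrite prodr_const card_ord.
rewrite bigA_distr_bigA /=.
rewrite (reindex (fun g : {ffun 'I_m -> T} => [tuple g i | i < m])) /=.
  by apply: eq_bigr => g _; apply: eq_bigr => j _; rewrite tnth_mktuple.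
exists (fun s : m.-tuple T => [ffun i => tnth s i]) => g _.
  by apply/ffunP => i; rewrite ffunE tnth_mktuple.
by apply: eq_from_tnth => i; rewrite tnth_mktuple ffunE.
Qed.

Variables (n : nat) (P : {ffun n.-tuple bool -> R}).
Hypothesis P_distr : is_distr P.

Lemma prob_samplesC m (E : m.-tuple (n.-tuple bool) -> Prop) :
  prob_samples P E = 1 - \sum_(s : m.-tuple (n.-tuple bool))
    (\prod_(j < m) P (tnth s j)) * (~~ `[< E s >])%:R.
Proof.
have tot : \sum_(s : m.-tuple (n.-tuple bool)) \prod_(j < m) P (tnth s j) = 1.
  by rewrite sum_tuple_prod (proj2 P_distr) expr1n.
rewrite -[X in X - _]tot -sumrB; apply: eq_bigr => s _.
by case: `[< _ >]; rewrite ?mulr1 ?mulr0 ?subr0 ?subrr.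
Qed.

(* Union bound over the programs no longer than [l], among which MDL selects. *)
Lemma mdl_PAC_of_short_program (phi : interp) sel (eps delta : R) f h0 l m :
  MDL_selector phi sel -> eps < 1 ->
  (forall x : n.-tuple bool, phi h0 (tval x) (f x)) -> (size h0 <= l)%N ->
  (forall m', (m <= m')%N -> (size (strings l))%:R * (1 - eps) ^+ m' <= delta) ->
  mdl_PAC phi sel eps delta f P m.
Proof.
move=> hsel heps hh0 hl hm m' hm'; rewrite prob_samplesC lerD2l lerN2.
apply: le_trans (hm m' hm').
pose good h (x : n.-tuple bool) : R := (`[< phi h (tval x) (f x) >])%:R.
pose bad h : bool := mdl_acc phi f P h < 1 - eps.
have good_ge0 h x : 0 <= good h x by rewrite ler0n.
have prodP_ge0 (s : m'.-tuple (n.-tuple bool)) : 0 <= \prod_(j < m') P (tnth s j).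
  by apply: prodr_ge0 => j _; apply: (proj1 P_distr).
(* A sample on which MDL fails is charged to the selected program, which is bad yet consistent with
   the sample. The product is the probability of the sample times the indicator of consistency. *)
apply: (@le_trans _ _ (\sum_(s : m'.-tuple (n.-tuple bool)) \sum_(h <- strings l)
    (bad h)%:R * \prod_(j < m') (P (tnth s j) * good h (tnth s j)))).
  apply: ler_sum => s _; set h := sel n (sample_dataset f s).
  have hv : mdl_valid phi (sample_dataset f s) h0.
    split=> [p /mapP[x _ ->]|x]; first exact: hh0 x.
    by exists (f x); apply: hh0.
  have [[hc _] hmin] := hsel n (sample_dataset f s) (ex_intro _ _ hv).
  have h_in : h \in strings l by apply: mem_strings; apply: leq_trans (hmin _ hv) hl.
  have pos h' : 0 <= (bad h')%:R * \prod_(j < m') (P (tnth s j) * good h' (tnth s j)).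
    apply: mulr_ge0; rewrite ?ler0n //; apply: prodr_ge0 => j _.
    by apply: mulr_ge0 => //; apply: (proj1 P_distr).
  rewrite (big_rem _ h_in) /=; apply: ler_wpDr; first by apply: sumr_ge0.
  rewrite big_split /= mulrC.
  have -> : \prod_(j < m') good h (tnth s j) = 1.
    apply: big1 => j _; rewrite /good; case: asboolP => //; case.
    have := hc (tnth s j, f (tnth s j)); apply; apply/mapP.
    by exists (tnth s j) => //; apply: mem_tnth.
  rewrite mulr1 ler_wpM2r // ler_nat /bad.
  by case: asboolP => //= /negP; rewrite -ltNge => ->.
rewrite exchange_big /=.
apply: (@le_trans _ _ (\sum_(h <- strings l) (1 - eps) ^+ m')).
  (* A bad program survives m' independent samples with probability the m'-th power of its
     accuracy. *)
  apply: ler_sum => h _; rewrite -mulr_sumr (sum_tuple_prod (fun x => P x * good h x)).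
  rewrite -/(mdl_acc phi f P h) /bad; case: ltP => hb; last first.
    by rewrite mul0r exprn_ge0 // subr_ge0 ltW.
  rewrite mul1r lerXn2r ?nnegrE ?subr_ge0 ?(ltW heps) ?(ltW hb) //.
  by apply: sumr_ge0 => x _; apply: mulr_ge0; rewrite ?(proj1 P_distr).
by rewrite big_const_seq count_predT iter_addr_0 mulr_natl.
Qed.

End Probability.

Section SampleComplexity.
Variable R : realType.
Local Open Scope ring_scope.

(** From (1 - eps)^m (1 + m eps) <= 1 it suffices that m delta eps exceeds C. *)
Lemma geometric_small (C eps delta : R) : 0 <= C -> 0 < eps < 1 -> 0 < delta ->
  exists2 m, (0 < m)%N & forall m', (m <= m')%N -> C * (1 - eps) ^+ m' <= delta.
Proof.
move=> hC /andP[e0 e1] hd.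
have bern m : (1 - eps) ^+ m * (1 + m%:R * eps) <= 1.
  elim: m => [|m IH]; first by rewrite expr0 mul0r addr0 mul1r.
  apply: le_trans IH; rewrite exprS -mulrA mulrCA ler_wpM2l //.
    by rewrite exprn_ge0 //; lra.
  by rewrite -natr1; have : 0 <= m%:R :> R by []; nra.
exists (Num.bound (C / (delta * eps))).+1 => // m' hm'.
have hb : C / (delta * eps) < m'%:R.
  apply: lt_le_trans (archi_boundP _) _; first by rewrite divr_ge0 // mulr_ge0; lra.
  by rewrite ler_nat; lia.
rewrite ltr_pdivrMr in hb; last by rewrite mulr_gt0.
have := bern m'; set u := (1 - eps) ^+ m' => hu.
have u0 : 0 <= u by rewrite exprn_ge0 //; lra.
have : delta * (u * (1 + m'%:R * eps)) <= delta * 1 by rewrite ler_wpM2l // ltW.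
have : u * C <= u * (m'%:R * (delta * eps)) by rewrite ler_wpM2l // ltW.
nra.
Qed.

Variables (phi : interp) (sel : forall n, dataset n -> seq bool) (eps delta : R).
Variables (n : nat) (f : n.-tuple bool -> bool) (P : {ffun n.-tuple bool -> R}).
Local Notation mcomp := (sample_complexity phi sel eps delta f P).

Lemma sample_complexity_le m : (0 < m)%N -> mdl_PAC phi sel eps delta f P m ->
  (mcomp <= (m%:R)%:E)%E.
Proof. by move=> m0 hm; apply: ereal_inf_lbound; exists m. Qed.

Lemma sample_complexity_ge m :
  (forall m', (0 < m')%N -> mdl_PAC phi sel eps delta f P m' -> (m <= m')%N) ->
  ((m%:R)%:E <= mcomp)%E.
Proof.
by move=> h; apply: le_ereal_inf_tmp => _ [m' [m0 hm'] <-]; rewrite lee_fin ler_nat h.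
Qed.

End SampleComplexity.

(** The two bounds on [y] make it a positive real, so that extended division by it is multiplication
    by a real inverse. *)
Lemma ereal_div_ge (R : realType) (a b : R) (x y : \bar R) : (0 < b)%R -> (0 <= a)%R ->
  (a%:E <= x)%E -> (1%:E <= y)%E -> (y <= b%:E)%E -> ((a / b)%:E <= x / y)%E.
Proof.
move=> b0 a0 hx; case: y => [y| |] //; rewrite !lee_fin => y1 yb.
have y0 : (0 < y)%R by apply: lt_le_trans y1.
rewrite inver (gt_eqF y0).
apply: (@le_trans _ _ (a%:E * (y^-1)%:E)%E).
  by rewrite -EFinM lee_fin ler_wpM2l // lef_pV2 // posrE.
by apply: lee_wpmul2r => //; rewrite lee_fin invr_ge0 ltW.
Qed.

(** * The lower bound *)

Lemma C_interp_enc n C x b : circuit_wf n C -> size x = n ->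
  C_interp (enc_circuit n C) x b -> circuit_eval C x = b.
Proof.
by move=> wC hx [C' []]; rewrite hx => wC' [/(enc_circuit_inj wC wC') -> <-].
Qed.

(** A decision tree for the samples is admissible, so the selected program is no longer than its
    encoding. *)
Lemma mdl_circuit_size sel n (f : n.-tuple bool -> bool) (L : seq (n.-tuple bool)) :
  MDL_selector C_interp sel -> 0 < n -> 0 < size L ->
  exists C, [/\ circuit_wf n C, size C <= 8 * size L
    & sel n [seq (x, f x) | x <- L] = enc_circuit n C].
Proof.
move=> hsel hn hL; have [C0 [w0 s0 e0]] := decision_tree f hn hL.
set S := map _ _; have hv : mdl_valid C_interp S (enc_circuit n C0).
  split=> [p /mapP[x hx ->] /=|x]; last first.
    by exists (circuit_eval C0 x), C0; rewrite size_tuple.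
  by exists C0; rewrite size_tuple e0.
have [[_ hb] hmin] := hsel n S (ex_intro _ _ hv).
(* An admissible program is defined on every input, in particular on the zero string, and this
   exhibits it as the encoding of a circuit. *)
have [b [C [wC [eC _]]]] := hb [tuple of nseq n false].
rewrite size_tuple in wC eC; exists C; split=> //.
have := hmin _ hv; rewrite eC !size_enc_circuit => h.
rewrite leqNgt; apply/negP => h'; move: h; rewrite leqNgt circ_len_lt //; lia.
Qed.

Definition hard_fun r K n (x : n.-tuple bool) : bool :=
  0 < bit (hard_table r K n) (binval x).

Lemma binval_tuple_lt n (x : n.-tuple bool) : binval x < 2 ^ n.
Proof. by have := binval_lt x; rewrite size_tuple. Qed.

Lemma sum_binval n (G : nat -> nat) :
  \sum_(x : n.-tuple bool) G (binval x) = \sum_(z < 2 ^ n) G z.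
Proof.
pose h (x : n.-tuple bool) := Ordinal (binval_tuple_lt x).
rewrite [RHS](reindex h) //; apply: onW_bij; apply: inj_card_bij.
  by move=> x y [] /binval_inj e; apply/val_inj/e; rewrite !size_tuple.
by rewrite card_ord card_tuple card_bool.
Qed.

Lemma hard_fun_gap r K n C : 2 <= r -> 5 <= n -> 6 * r * r < K ->
  circuit_wf n C -> size C <= hard_size K n ->
  2 * r * (\sum_(x : n.-tuple bool) (circuit_eval C x == hard_fun r K x)) < 2 ^ n * (r + 2).
Proof.
move=> hr hn hK wC sC.
have [c hc hce] := circuit_code wC sC (leqnn (code_base K n)).
apply: leq_ltn_trans (hard_table_gap hr hn hK hc).
rewrite leq_mul2l -(sum_binval n (fun z => code_eval n _ _ c z == bit _ z)).
apply/orP; right; apply: leq_sum => x _; rewrite hce ?size_tuple // /hard_fun.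
by have := bit_le1 (hard_table r K n) (binval x); case: (bit _ _) => [|[]] //;
  case: (circuit_eval _ _).
Qed.

Section LowerBound.
Variables (R : realType) (eps delta : R) (r K n : nat).
Hypotheses (delta_lt1 : (delta < 1)%R) (r_ge2 : 2 <= r) (n_ge5 : 5 <= n).
Hypotheses (r_eps : (r%:R^-1 <= 1 / 2 - eps :> R)%R) (K_large : 6 * r * r < K).
Variable sel : forall n, dataset n -> seq bool.
Hypothesis selP : MDL_selector C_interp sel.

Definition uniform : {ffun n.-tuple bool -> R} := [ffun=> ((2 ^ n)%:R^-1)%R].

Lemma uniform_distr : is_distr uniform.
Proof.
split=> [x|]; first by rewrite ffunE invr_ge0 ler0n.
under eq_bigr => x _ do rewrite ffunE.
rewrite sumr_const card_tuple card_bool -[LHS]mulr_natl divff // pnatr_eq0 expn_eq0.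
Qed.

(** Divided by 2^n, the gap bounds the accuracy strictly by 1/2 + 1/r, which is at most 1 - eps. *)
Lemma hard_acc_lt C : circuit_wf n C -> size C <= hard_size K n ->
  (mdl_acc C_interp (hard_fun r K (n:=n)) uniform (enc_circuit n C) < 1 - eps)%R.
Proof.
move=> wC sC; have := hard_fun_gap r_ge2 n_ge5 K_large wC sC.
set a := \sum_x _ => ha.
have N_gt0 : (0 < (2 ^ n)%:R :> R)%R by rewrite ltr0n expn_gt0.
have r_gt0 : (0 < r%:R :> R)%R by rewrite ltr0n; lia.
apply: (@le_lt_trans _ _ ((2 ^ n)%:R^-1 * a%:R)%R).
  rewrite /mdl_acc natr_sum mulr_sumr; apply: ler_sum => x _; rewrite ffunE.
  rewrite ler_wpM2l ?invr_ge0 ?ler0n // ler_nat; case: asboolP => // h.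
  by rewrite (C_interp_enc wC (size_tuple x) h) eqxx.
rewrite mulrC ltr_pdivrMr //.
have : ((2 * r * a)%:R < (2 ^ n * (r + 2))%:R :> R)%R by rewrite ltr_nat.
rewrite !natrM natrD; move: ((2 ^ n)%:R)%R N_gt0 => N N_gt0 h.
have h1 : (1 <= (1 / 2 - eps) * r%:R)%R 
  by move: r_eps; rewrite -[leLHS]mul1r ler_pdivrMr.
have h2 : (N * 1 <= N * ((1 / 2 - eps) * r%:R))%R by rewrite ler_wpM2l // ltW.
rewrite -(@ltr_pM2l _ (2 * r%:R)%R); last by apply: mulr_gt0; rewrite // ltr0n.
by nra.
Qed.

(** PAC performance from fewer than [m] samples includes success at exactly [m] samples. There the
    selected circuit always has at most 8 m vertices, so the success event is empty. *)
Lemma hard_complexity_ge m : 0 < m -> 8 * m <= hard_size K n ->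
  ((m%:R)%:E <= sample_complexity C_interp sel eps delta (hard_fun r K (n:=n)) uniform)%E.
Proof.
move=> hm hS; apply: sample_complexity_ge => m' _ hPAC.
rewrite leqNgt; apply/negP => hlt; have := hPAC m (ltnW hlt).
rewrite /prob_samples big1 ?subr_le0 ?leNgt ?delta_lt1 // => s _.
case: asboolP => //; last by rewrite mulr0.
have [||C [wC sC ->]] := mdl_circuit_size (hard_fun r K (n:=n)) (L := s) selP.
- by lia.
- by rewrite size_tuple.
by rewrite size_tuple in sC; rewrite leNgt hard_acc_lt //; lia.
Qed.
End LowerBound.

Lemma square_le_exp2 n : 4 <= n -> n * n <= 2 ^ n.
Proof.
elim: n => // n IH hn; have [h|h] := ltnP n 4; last by rewrite expnS; have := IH h; nia.
by have -> : n = 3 by lia.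
Qed.

(* For every fixed number k >= 1 of work tapes, every prefix-free encoding E *)
(* of machines, and every tie-breaking rule of MDL^U and MDL^C:              *)
(* for all eps in (0,1/2), delta in (0,1), d >= 1,                           *)
(* G^d_{U -> C}(eps,delta,n) = Omega(2^n / n) as n -> oo.                    *)
Theorem theorem2 (R : realType) (k : nat) (E : TM k -> seq bool)
    (selU selC : forall n, dataset n -> seq bool) :
  (0 < k)%N -> prefix_free_enc E ->
  MDL_selector (U_interp E) selU -> MDL_selector C_interp selC ->
  forall (eps delta : R) (d : nat),
    (0 < eps < 1 / 2)%R -> (0 < delta < 1)%R -> (0 < d)%N ->
    exists (c : R) (N : nat), (0 < c)%R /\
      forall n : nat, (N <= n)%N -> (0 < n)%N ->
        (((c * 2 ^+ n / n%:R)%R)%:E <=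
           gain (U_interp E) C_interp selU selC eps delta n d)%E.
Proof.
(* The constructed machine needs one work tape; any others stay blank. *)
case: k E => [|k] E // _ _ hU hC eps delta d /andP[eps0 eps1] /andP[delta0 delta1] hd.
have eps_half : (0 < 1 / 2 - eps)%R by lra.
(* The archimedean bound gives 1/r <= 1/2 - eps, and the summand 2 gives r >= 2. *)
pose r := (Num.bound (1 / 2 - eps)^-1 + 2)%N.
have r_ge2 : (2 <= r)%N by rewrite /r; lia.
have r_eps : (r%:R^-1 <= 1 / 2 - eps :> R)%R.
  have r_gt0 : (0 < r%:R :> R)%R by rewrite ltr0n; lia.
  rewrite invf_ple ?posrE //.
  rewrite natrD; apply: le_trans (_ : (Num.bound (1 / 2 - eps)^-1)%:R <= _)%R.
    by apply/ltW/archi_boundP; rewrite invr_ge0 ltW.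
  by rewrite lerDl ler0n.
pose K := (6 * r * r).+1.
have [T hT] := machine_of_computable k (computable_hard_bit r K).
pose l := size (E T).
have [|||mU mU_gt0 hmU] := @geometric_small R (size (strings l))%:R eps delta.
- by rewrite ler0n.
- by apply/andP; split; lra.
- by [].
(* From n >= l, the description length is at most n^d. From n >= 32 K and n^2 <= 2^n, the size S is
   at least 32, so m = S / 8 rounded down satisfies S < 16 m. Then 2^n < (S + 1) K n <= 16 m K n,
   which is where the constant comes from. *)
exists ((16 * K * mU)%:R^-1)%R, (l + 32 * K)%N; split.
  by rewrite invr_gt0 ltr0n; lia.
move=> n hn n_gt0.
have n_ge5 : (5 <= n)%N by rewrite /K in hn; nia.
pose f := hard_fun r K (n:=n); pose P := @uniform R n.
have hprog x : U_interp E (E T ++ [::]) (tval x) (f x).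
  by exists T, [::]; split=> //; have := hT x; rewrite /input_regs /= size_tuple.
apply: le_ereal_sup_tmp.
exists (sample_complexity C_interp selC eps delta f P /
        sample_complexity (U_interp E) selU eps delta f P)%E.
  exists f, P; split=> //; first exact: uniform_distr.
  apply: ge_ereal_inf; exists (l%:R)%:E; last first.
    rewrite lee_fin ler_nat; apply: leq_trans (leq_pexp2l n_gt0 hd); lia.
  by exists (E T ++ [::]) => //; rewrite cats0.
pose m := (hard_size K n %/ 8)%N.
have hsize : (2 ^ n < (hard_size K n).+1 * (K * n))%N by apply: ltn_ceil; rewrite muln_gt0.
have hsq := @square_le_exp2 n ltac:(lia).
have hbig : (32 * (K * n) <= 2 ^ n)%N.
  by apply: leq_trans hsq; rewrite mulnA leq_mul2r; apply/orP; right; lia.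
have hm32 : (31 < hard_size K n)%N.
  by rewrite -ltnS -(@ltn_pmul2r (K * n)) ?muln_gt0 //; apply: leq_ltn_trans hsize.
apply: (@le_trans _ _ ((m%:R / mU%:R)%:E)).
  rewrite lee_fin -natrX ler_pdivrMr ?ltr0n // mulrAC ler_pdivlMr ?ltr0n //.
  rewrite -mulrA ler_pdivrMl ?ltr0n; last by lia.
  rewrite -!natrM ler_nat.
  have : (hard_size K n < 16 * m)%N by rewrite /m; lia.
  have hK : (0 < K * n)%N by rewrite muln_gt0.
  move: (hard_size K n) hsize => s hsize hs.
  have : (s.+1 * (K * n) <= 16 * m * (K * n))%N by rewrite leq_mul2r hs orbT.
  move=> h; rewrite (_ : 16 * K * mU * (m * n) = 16 * m * (K * n) * mU)%N; last by lia.
  by rewrite leq_mul2r (leq_trans (ltnW hsize) h) orbT.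
apply: ereal_div_ge; rewrite ?ltr0n ?ler0n //.
- by apply: hard_complexity_ge => //; rewrite /m; lia.
- by apply: (sample_complexity_ge (m := 1)).
apply: sample_complexity_le => //.
have eps_lt1 : (eps < 1)%R by lra.
apply: (mdl_PAC_of_short_program (uniform_distr R n) hU eps_lt1 hprog _ hmU).
by rewrite cats0.
Qed.
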